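(* Let $X'$ be a visual Gromov hyperbolic metric space such that its boundary at infinity $\partial_\infty X'$, equipped with a visual metric, is a doubling metric space, and let $n=\operatorname{cdim}\partial_\infty X'<\infty$ be the capacity dimension of this boundary. Then $X'$ admits a quasi-isometric embedding into the product of $n+1$ copies of the binary metric tree (with the $\ell_1$ product metric).
   Context: Gromov product: $(x|y)_z=\frac12(|zx|+|zy|-|xy|)$. A triple $(a_1,a_2,a_3)$ of reals is a $\delta$-triple if $a_\mu\ge\min\{a_{\mu+1},a_{\mu+2}\}-\delta$ for $\mu=1,2,3$ (indices mod 3). $X$ is $\delta$-hyperbolic if $((x|y)_o,(y|z)_o,(x|z)_o)$ is a $\delta$-triple for all $o,x,y,z$; hyperbolic if $\delta$-hyperbolic for some $\delta\ge0$. A sequence $(x_i)$ converges to infinity if $(x_i|x_j)_o\to\infty$ as $i,j\to\infty$; two such sequences are equivalent if $(x_i|x'_i)_o\to\infty$; $\partial_\infty X$ is the set of equivalence classes. For $\xi,\xi'\in\partial_\infty X$, $(\xi|\xi')_o=\inf\liminf_i(x_i|x'_i)_o$ over representatives. A metric $d$ on $\partial_\infty X$ is visual if there are $o\in X$, $a>1$, $c_1,c_2>0$ with $c_1a^{-(\xi|\xi')_o}\le d(\xi,\xi')\le c_2a^{-(\xi|\xi')_o}$. A hyperbolic space $Y$ is visual if for some $o\in Y$ there is $D>0$ such that for every $y\in Y$ there is $\xi\in\partial_\infty Y$ with $|oy|\le(y|\xi)_o+D$. A metric space is doubling if there is $C\ge1$ such that every ball of radius $\rho$ can be covered by at most $C$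 balls of radius $\rho/2$. Capacity dimension: for a family $\mathcal U$ of subsets of a metric space $Z$, $\operatorname{mesh}\mathcal U=\sup_{U\in\mathcal U}\operatorname{diam}U$. An open covering $\mathcal U$ is $m$-colored if $\mathcal U=\bigcup_{c\in C}\mathcal U^c$ with $|C|=m$ and each $\mathcal U^c$ consists of pairwise disjoint sets. For an open covering, $L(\mathcal U,z)=\min\{\sup_{U\in\mathcal U}\operatorname{dist}(z,Z\setminus U),\operatorname{mesh}\mathcal U\}$ and $L(\mathcal U)=\inf_{z\in Z}L(\mathcal U,z)$. The capacity dimension $\operatorname{cdim}Z$ is the minimal integer $m\ge0$ such that there is $\delta>0$ so that for every sufficiently small $\tau>0$ there exists an $(m+1)$-colored open covering $\mathcal U$ of $Z$ with $\operatorname{mesh}\mathcal U\le\tau$ and $L(\mathcal U)\ge\delta\tau$. The binary metric tree is the simplicial tree with all vertices of valence 3 and edges of length 1; a quasi-isometric embedding is a map $f$ with $a_1|xx'|-b\le|f(x)f(x')|\le a_2|xx'|+b$ for constants $a_1,a_2>0,b\ge0$. *)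

(* Defs.v *)
From Stdlib Require Import Reals Lra List.
From Coquelicot Require Import Coquelicot.
Open Scope R_scope.

Definition is_metric {T : Type} (d : T -> T -> R) : Prop :=
  (forall x y, 0 <= d x y) /\ (forall x y, d x y = 0 <-> x = y) /\
  (forall x y, d x y = d y x) /\ (forall x y z, d x z <= d x y + d y z).

Definition ball {T : Type} (d : T -> T -> R) (z : T) (r : R) : T -> Prop :=
  fun w => d z w < r.

Definition is_open {T : Type} (d : T -> T -> R) (U : T -> Prop) : Prop :=
  forall z, U z -> exists r, 0 < r /\ forall w, ball d z r w -> U w.

Definition gromov {X : Type} (d : X -> X -> R) (o x y : X) : R :=
  (d o x + d o y - d x y) / 2.

Definition delta_triple (delta a1 a2 a3 : R) : Prop :=
  a1 >= Rmin a2 a3 - delta /\ a2 >= Rmin a3 a1 - delta /\ a3 >= Rmin a1 a2 - delta.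

Definition delta_hyperbolic {X : Type} (d : X -> X -> R) (delta : R) : Prop :=
  forall o x y z, delta_triple delta (gromov d o x y) (gromov d o y z) (gromov d o x z).

Definition hyperbolic {X : Type} (d : X -> X -> R) : Prop :=
  exists delta, 0 <= delta /\ delta_hyperbolic d delta.

(* (x_i) converges to infinity: (x_i|x_j)_o -> oo as i,j -> oo
   (independent of the base point o; we require it for every o). *)
Definition conv_inf {X : Type} (d : X -> X -> R) (x : nat -> X) : Prop :=
  forall o : X, forall M : R, exists N : nat,
    forall i j, (N <= i)%nat -> (N <= j)%nat -> M <= gromov d o (x i) (x j).

Definition seq_equiv {X : Type} (d : X -> X -> R) (x y : nat -> X) : Prop :=
  forall o : X, forall M : R, exists N : nat,
    forall i, (N <= i)%nat -> M <= gromov d o (x i) (y i).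

Definition boundary {X : Type} (d : X -> X -> R) : Type :=
  { S : (nat -> X) -> Prop |
      exists x, conv_inf d x /\ S = (fun y => conv_inf d y /\ seq_equiv d x y) }.

Definition repr {X : Type} {d : X -> X -> R} (xi : boundary d) : (nat -> X) -> Prop :=
  proj1_sig xi.

Definition gromov_bd {X : Type} (d : X -> X -> R) (o : X) (xi xi' : boundary d) : Rbar :=
  Rbar_glb (fun t => exists x y, repr xi x /\ repr xi' y /\
                       t = LimInf_seq (fun i => gromov d o (x i) (y i))).

Definition gromov_pt_bd {X : Type} (d : X -> X -> R) (o y : X) (xi : boundary d) : Rbar :=
  Rbar_glb (fun t => exists x, repr xi x /\
                       t = LimInf_seq (fun i => gromov d o y (x i))).

Definition rpow_neg (a : R) (t : Rbar) : R :=
  match t with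
  | Finite r => Rpower a (- r)
  | p_infty => 0
  | m_infty => 0 (* never occurs: Gromov products are nonnegative *)
  end.

Definition visual_metric {X : Type} (d : X -> X -> R) (db : boundary d -> boundary d -> R) : Prop :=
  exists (o : X) (a c1 c2 : R), 1 < a /\ 0 < c1 /\ 0 < c2 /\
    forall xi xi', c1 * rpow_neg a (gromov_bd d o xi xi') <= db xi xi' /\
                   db xi xi' <= c2 * rpow_neg a (gromov_bd d o xi xi').

Definition visual_space {Y : Type} (d : Y -> Y -> R) : Prop :=
  exists (o : Y) (D : R), 0 < D /\
    forall y : Y, exists xi : boundary d,
      Rbar_le (Finite (d o y)) (Rbar_plus (gromov_pt_bd d o y xi) (Finite D)).

Definition doubling {Z : Type} (d : Z -> Z -> R) : Prop :=
  exists C : nat, (1 <= C)%nat /\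
    forall (z : Z) (rho : R), 0 < rho ->
      exists centers : list Z, (length centers <= C)%nat /\
        forall w, ball d z rho w -> exists c, In c centers /\ ball d c (rho / 2) w.

(* A family of subsets of Z is a predicate on subsets.  A colored family with
   colors 0..m is given by F : nat -> family; its underlying family is the union
   of F c for c < m+1. *)
Definition family (Z : Type) := (Z -> Prop) -> Prop.

Definition diam {Z : Type} (d : Z -> Z -> R) (U : Z -> Prop) : Rbar :=
  Rbar_lub (fun t => exists x y, U x /\ U y /\ t = Finite (d x y)).

Definition mesh {Z : Type} (d : Z -> Z -> R) (U : family Z) : Rbar :=
  Rbar_lub (fun t => exists A, U A /\ t = diam d A).

Definition dist_compl {Z : Type} (d : Z -> Z -> R) (z : Z) (A : Z -> Prop) : Rbar :=
  Rbar_glb (fun t => exists w, ~ A w /\ t = Finite (d z w)).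

Definition Lz {Z : Type} (d : Z -> Z -> R) (U : family Z) (z : Z) : Rbar :=
  Rbar_min (Rbar_lub (fun t => exists A, U A /\ t = dist_compl d z A)) (mesh d U).

Definition Lcov {Z : Type} (d : Z -> Z -> R) (U : family Z) : Rbar :=
  Rbar_glb (fun t => exists z, t = Lz d U z).

Definition union_colors {Z : Type} (k : nat) (F : nat -> family Z) : family Z :=
  fun A => exists c, (c < k)%nat /\ F c A.

Definition open_covering {Z : Type} (d : Z -> Z -> R) (U : family Z) : Prop :=
  (forall A, U A -> is_open d A) /\ (forall z, exists A, U A /\ A z).

Definition colored {Z : Type} (k : nat) (F : nat -> family Z) : Prop :=
  forall c A B, (c < k)%nat -> F c A -> F c B -> A <> B -> forall z, ~ (A z /\ B z).

Definition cdim_witness {Z : Type} (d : Z -> Z -> R) (m : nat) : Prop :=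
  exists delta, 0 < delta /\ exists tau0, 0 < tau0 /\
    forall tau, 0 < tau -> tau <= tau0 ->
      exists F : nat -> family Z,
        colored (S m) F /\ open_covering d (union_colors (S m) F) /\
        Rbar_le (mesh d (union_colors (S m) F)) (Finite tau) /\
        Rbar_le (Finite (delta * tau)) (Lcov d (union_colors (S m) F)).

Definition cdim_eq {Z : Type} (d : Z -> Z -> R) (n : nat) : Prop :=
  cdim_witness d n /\ forall m, (m < n)%nat -> ~ cdim_witness d m.

(* The simplicial tree with all vertices of valence 3 and edges of length 1,
   as a metric (geodesic) tree.  Rooted presentation: vertices are words
   [a0; a1; ...; ak] with a0 < 3 and ai < 2 (i >= 1); the empty word is the
   root (3 children), every other vertex has 1 parent and 2 children.
   A point is (v, h): the root is ([], 0); a point with word v <> [] lies on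
   the edge from the parent of v to v, at height h (distance from the root)
   with |v|-1 < h <= |v| (h = |v| is the vertex v itself). *)
Definition valid_word (v : list nat) : Prop :=
  match v with
  | nil => True
  | a :: w => (a < 3)%nat /\ List.Forall (fun b => (b < 2)%nat) w
  end.

Definition tree_point_ok (p : list nat * R) : Prop :=
  valid_word (fst p) /\
  ((fst p = nil /\ snd p = 0) \/
   (fst p <> nil /\ INR (length (fst p)) - 1 < snd p /\ snd p <= INR (length (fst p)))).

Definition BTree : Type := { p : list nat * R | tree_point_ok p }.

Fixpoint lcp_len (v w : list nat) : nat :=
  match v, w with
  | a :: v', b :: w' => if Nat.eqb a b then S (lcp_len v' w') else O
  | _, _ => O
  end.

(* geodesic distance: h(p) + h(q) - 2 * height of the branching point *)
Definition tree_dist (p q : BTree) : R :=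
  let (v, s) := proj1_sig p in
  let (w, t) := proj1_sig q in
  s + t - 2 * Rmin (INR (lcp_len v w)) (Rmin s t).

(* l1 product of n+1 copies (coordinates 0..n) *)
Definition prod_dist (n : nat) (P Q : nat -> BTree) : R :=
  sum_f_R0 (fun i => tree_dist (P i) (Q i)) n.

Definition qi_embedding {X Y : Type} (dX : X -> X -> R) (dY : Y -> Y -> R) (f : X -> Y) : Prop :=
  exists a1 a2 b, 0 < a1 /\ 0 < a2 /\ 0 <= b /\
    forall x x', a1 * dX x x' - b <= dY (f x) (f x') /\ dY (f x) (f x') <= a2 * dX x x' + b.

(* Main.v *)
(** Each point [x] of the space is coarsely determined by a boundary point [xi x] with [|ox|
    <= (x|xi x)_o + D] and by [|ox|], so the space is the hyperbolic cone over its boundary: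
    up to constants [(x|y)_o] is [min {|ox|, |oy|, (xi x|xi y)_o}].

    The capacity dimension yields, at every scale [tau0 r^t], covers in [n+1] colours.
    Enlarging each member by the finer members of the same colour that touch it makes every
    colour laminar: a member of a finer scale is deep inside, or far away from, any coarser
    one. For a boundary point and a colour, the members containing it form a chain;
    recording one letter per member gives a word, and words are points of a tree. Every
    scale is visited in some colour, so the words of the [n+1] colours have total length at
    least the number of scales, and laminarity makes them change by at most one letter under
    small moves.

    For the trees to be binary the letters must come from a finite alphabet although a
    member may have unboundedly many children, since a colour may be absent on many
    consecutive scales. Doubling gives a finite labelling that separates points at
    comparable distances, and the word of a colour is a diary: at each visit the [Q] most
    recent not yet recorded scales are written down, each with its label and with a stamp
    from an aperiodic sequence. If two words agreed on a positive proportion of the letters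
    written after the scale [J] where the two points separate, the stamps would synchronise
    the two diaries, and both would contain the label at scale [J] or [J + 1], which
    differs. *)

From Coquelicot Require Import Coquelicot.
From Stdlib Require Import Reals Lra Lia List Arith Classical ClassicalEpsilon.
Require Import Defs.
Import ListNotations.
Open Scope R_scope.

(** * Preliminaries on naturals, lists, extended reals and exponents *)

Lemma last_before (P : nat -> Prop) (k : nat) :
  (exists t, (t < k)%nat /\ P t /\ forall s, (t < s < k)%nat -> ~ P s) \/
  (forall s, (s < k)%nat -> ~ P s).
Proof.
  induction k as [|k IH]; [right; intros; lia|].
  destruct (classic (P k)) as [Hk|Hk].
  - left. exists k. repeat split; auto. intros; lia.
  - destruct IH as [(t & H1 & H2 & H3) | H].
    + left. exists t. repeat split; auto. intros s Hs.
      destruct (Nat.eq_dec s k) as [->|]; auto. apply H3. lia.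
    + right. intros s Hs. destruct (Nat.eq_dec s k) as [->|]; auto. apply H. lia.
Qed.

Lemma first_before (P : nat -> Prop) (k : nat) :
  (exists t, (t < k)%nat /\ P t /\ forall s, (s < t)%nat -> ~ P s) \/
  (forall s, (s < k)%nat -> ~ P s).
Proof.
  induction k as [|k IH]; [right; intros; lia|].
  destruct IH as [(t & H1 & H2 & H3) | H].
  - left. exists t. repeat split; auto.
  - destruct (classic (P k)) as [Hk|Hk].
    + left. exists k. auto.
    + right. intros s Hs. destruct (Nat.eq_dec s k) as [->|]; auto. apply H. lia.
Qed.

Lemma app_eq_length {A : Type} (x y u v : list A) :
  length x = length y -> x ++ u = y ++ v -> x = y /\ u = v.
Proof.
  revert y. induction x as [|a x IH]; intros [|b y] Hl H; simpl in *; try discriminate; auto.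
  injection H as -> H. destruct (IH y ltac:(lia) H) as [-> ->]. auto.
Qed.

Lemma common_prefix {A : Type} (u v : list A) : exists w u' v', u = w ++ u' /\ v = w ++ v' /\
  (u' = [] \/ v' = [] \/ exists a b u2 v2, u' = a :: u2 /\ v' = b :: v2 /\ a <> b).
Proof.
  revert v. induction u as [|a u IH]; intros v.
  - exists [], [], v. auto.
  - destruct v as [|b v]; [exists [], (a :: u), []; auto|].
    destruct (classic (a = b)) as [->|Hn].
    + destruct (IH v) as (w & u' & v' & -> & -> & H). exists (b :: w), u', v'. auto.
    + exists [], (a :: u), (b :: v). repeat split. right. right. eauto 8.
Qed.

Lemma sum_f_R0_term_le (a : nat -> R) (N i : nat) :
  (forall j, 0 <= a j) -> (i <= N)%nat -> a i <= sum_f_R0 a N.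
Proof.
  intros Ha Hi. induction Hi as [|N Hi IH].
  - destruct i as [|i]; simpl; [lra|]. pose proof (cond_pos_sum a i Ha). lra.
  - simpl. specialize (Ha (S N)). lra.
Qed.

Lemma fresh_color (used : list nat) M : (length used < M)%nat -> exists c, (c < M)%nat /\ ~ In c used.
Proof.
  intro H. apply NNPP. intro Hno.
  assert (incl (seq 0 M) used).
  { intros c Hc. apply in_seq in Hc. apply NNPP. intro. apply Hno. exists c. split; [lia|assumption]. }
  pose proof (NoDup_incl_length (seq_NoDup M 0) H0) as L. rewrite length_seq in L. lia.
Qed.

Lemma pow2_ge (x : R) : exists i, x <= 2 ^ i.
Proof.
  destruct (Pow_x_infinity 2 ltac:(rewrite Rabs_pos_eq; lra) x) as (N & HN).
  exists N. specialize (HN N (le_n N)). rewrite Rabs_pos_eq in HN; [lra|]. apply pow_le. lra.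
Qed.

Lemma Rbar_lub_ub (E : Rbar -> Prop) x : E x -> Rbar_le x (Rbar_lub E).
Proof. exact (proj1 (proj2_sig (Rbar_ex_lub E)) x). Qed.

Lemma Rbar_lub_least (E : Rbar -> Prop) b :
  (forall x, E x -> Rbar_le x b) -> Rbar_le (Rbar_lub E) b.
Proof. exact (proj2 (proj2_sig (Rbar_ex_lub E)) b). Qed.

Lemma Rbar_glb_lb (E : Rbar -> Prop) x : E x -> Rbar_le (Rbar_glb E) x.
Proof. exact (proj1 (proj2_sig (Rbar_ex_glb E)) x). Qed.

Lemma Rbar_glb_greatest (E : Rbar -> Prop) b :
  (forall x, E x -> Rbar_le b x) -> Rbar_le b (Rbar_glb E).
Proof. exact (proj2 (proj2_sig (Rbar_ex_glb E)) b). Qed.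

Lemma LimInf_seq_gt (u : nat -> R) (a : R) :
  Rbar_lt (Finite a) (LimInf_seq u) -> exists N, forall i, (N <= i)%nat -> a < u i.
Proof.
  unfold LimInf_seq. destruct (ex_LimInf_seq u) as [l Hl]. simpl. intro H.
  destruct l as [l| |]; simpl in *.
  - destruct (Hl (mkposreal (l - a) ltac:(lra))) as [_ [N HN]]. exists N. intros i Hi.
    specialize (HN i Hi). simpl in HN. lra.
  - destruct (Hl a) as [N HN]. now exists N.
  - destruct H.
Qed.

Lemma LimInf_seq_ge (u : nat -> R) (a : R) :
  (exists N, forall i, (N <= i)%nat -> a <= u i) -> Rbar_le (Finite a) (LimInf_seq u).
Proof.
  intros [N HN]. rewrite <- (LimInf_seq_const a). apply LimInf_le. exists N. exact HN.
Qed.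

Lemma Rpower_neg_le_exponent (a k k' s t : R) : 1 < a -> 0 < k -> 0 < k' ->
  k * Rpower a (- s) <= k' * Rpower a (- t) -> t <= s + (ln k' - ln k) / ln a.
Proof.
  intros Ha Hk Hk' H.
  assert (Hla : 0 < ln a) by (rewrite <- ln_1; apply ln_increasing; lra).
  apply ln_le in H; [|apply Rmult_lt_0_compat; [lra|apply exp_pos]].
  rewrite !ln_mult in H by (try lra; apply exp_pos). rewrite !ln_Rpower in H.
  apply Rmult_le_reg_r with (ln a); [exact Hla|].
  replace ((s + (ln k' - ln k) / ln a) * ln a) with (s * ln a + (ln k' - ln k)) by (field; lra).
  lra.
Qed.

(** * Diaries *)

Fixpoint two_adic_parity_pos (p : positive) : bool :=
  match p with xO q => negb (two_adic_parity_pos q) | _ => false end.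

(* The parity of the 2-adic valuation of [t + 1]. *)
Definition stamp (t : nat) : bool := two_adic_parity_pos (Pos.of_succ_nat t).

Lemma stamp_even (t : nat) : stamp (2 * t) = false.
Proof.
  unfold stamp. destruct t as [|t]; [reflexivity|].
  replace (Pos.of_succ_nat (2 * S t)) with (xI (Pos.of_succ_nat t)) by lia.
  reflexivity.
Qed.

Lemma stamp_odd (t : nat) : stamp (2 * t + 1) = negb (stamp t).
Proof.
  unfold stamp.
  replace (Pos.of_succ_nat (2 * t + 1)) with (xO (Pos.of_succ_nat t)) by lia.
  reflexivity.
Qed.

(** An even shift is halved by passing to odd positions, whose stamps are the negated stamps at half
    the position. For an odd shift [2 * g' + 1], positions [2 * q] carry [false], and when [q + g']
    is even the shifted position carries [true]; such a position occurs in every window of length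
    4. *)
Lemma stamp_aperiodic (g a : nat) :
  (0 < g)%nat -> exists s, (a <= s < a + 4 * g)%nat /\ stamp s <> stamp (s + g).
Proof.
  revert a. induction g as [g IH] using lt_wf_ind. intros a Hg.
  destruct (Nat.Even_or_Odd g) as [[g' Hg'] | [g' Hg']].
  - destruct (IH g' ltac:(lia) ((a) / 2)%nat ltac:(lia)) as [s [Hs Hne]].
    exists (2 * s + 1)%nat.
    pose proof (Nat.div_mod_eq a 2). pose proof (Nat.mod_upper_bound a 2).
    split; [lia|].
    replace (2 * s + 1 + g)%nat with (2 * (s + g') + 1)%nat by lia.
    rewrite !stamp_odd. intro E. apply Hne.
    destruct (stamp s), (stamp (s + g')); simpl in E; congruence.
  - assert (Hs : exists q, (a <= 2 * q < a + 4)%nat /\ Nat.Even (q + g')).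
    { pose proof (Nat.div_mod_eq (a+1) 2). pose proof (Nat.mod_upper_bound (a+1) 2).
      destruct (Nat.Even_or_Odd ((a + 1) / 2 + g')) as [E|O].
      - exists ((a + 1) / 2)%nat. split; [lia|exact E].
      - exists (S ((a + 1) / 2)). split; [lia|]. destruct O as [w Hw]. exists (S w). lia. }
    destruct Hs as [q [Hq [w Hw]]]. exists (2 * q)%nat. split; [lia|].
    replace (2 * q + g)%nat with (2 * (2 * w) + 1)%nat by lia.
    rewrite stamp_odd, !stamp_even. discriminate.
Qed.

Section Diary.

Variable T : Type.
Variable Q : nat.
Variable label : nat -> T -> nat.

(** The label is evaluated at the visiting point [p] but at the pending scale [s], which may be much
    coarser than the scale of the visit. Label and stamp can be read off the code, and 0 is reserved
    for [None]. *)
Definition code (p : T) (o : option nat) : nat :=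
  match o with
  | None => 0
  | Some s => S (2 * label s p + Nat.b2n (stamp s))
  end.

Definition down (t b : nat) : list (option nat) := map Some (rev (seq b (S t - b))).

Definition letter (p : T) (st : list (option nat)) : list nat :=
  map (fun i => code p (nth i st None)) (seq 0 Q).

(* The stack lists the scales not yet recorded, most recent first, with [None] at each past
   visit; reading below its bottom also gives [None]. *)
Fixpoint enc (st : list (option nat)) (b : nat) (vs : list (nat * T)) : list (list nat) :=
  match vs with
  | [] => []
  | (t, p) :: vs' =>
      letter p (down t b ++ st) :: enc (None :: skipn Q (down t b ++ st)) (S t) vs'
  end.

Fixpoint increasing_from (b : nat) (vs : list (nat * T)) : Prop :=
  match vs with
  | [] => True
  | (t, _) :: vs' => (b <= t)%nat /\ increasing_from (S t) vs'
  end.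

Definition end_time (b : nat) (vs : list (nat * T)) : nat :=
  fold_left (fun _ v => S (fst v)) vs b.

Lemma code_None (p p' : T) o o' : code p o = code p' o' -> o = None <-> o' = None.
Proof. destruct o, o'; simpl; intro H; split; congruence. Qed.

Lemma code_Some (p p' : T) s s' :
  code p (Some s) = code p' (Some s') -> label s p = label s' p' /\ stamp s = stamp s'.
Proof.
  simpl. intro H. destruct (stamp s), (stamp s'); simpl in H; split; try reflexivity; lia.
Qed.

Lemma down_length t b : length (down t b) = (S t - b)%nat.
Proof. unfold down. now rewrite length_map, length_rev, length_seq. Qed.

Lemma nth_down t b st x :
  (x < S t - b)%nat -> nth x (down t b ++ st) None = Some (t - x)%nat.
Proof.
  intro H. rewrite app_nth1 by (now rewrite down_length).
  unfold down. rewrite nth_indep with (d' := Some 0%nat) by (now rewrite length_map, length_rev, length_seq).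
  rewrite map_nth, rev_nth by (now rewrite length_seq).
  rewrite length_seq, seq_nth by lia. f_equal. lia.
Qed.

Lemma nth_down_bottom t b st x :
  nth 0 st None = None -> (x = S t - b)%nat -> nth x (down t b ++ st) None = None.
Proof.
  intros H ->. rewrite app_nth2 by (rewrite down_length; lia).
  now rewrite down_length, Nat.sub_diag.
Qed.

Lemma letter_eq (p p' : T) st st' x :
  letter p st = letter p' st' -> (x < Q)%nat ->
  code p (nth x st None) = code p' (nth x st' None).
Proof.
  intros H Hx. unfold letter in H.
  apply (proj1 map_ext_in_iff H x).
  apply in_seq. lia.
Qed.

Lemma enc_length st b vs : length (enc st b vs) = length vs.
Proof.
  revert st b. induction vs as [|[t p] vs IH]; intros; simpl; [reflexivity|].
  now rewrite IH.
Qed.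

(** Relates the parts of two stacks pushed since a comparison began: equally many blocks, each
    closed by a marker [None]. The blocks may differ in length because the two runs are visited at
    different times. *)
Inductive same_blocks : list (option nat) -> list (option nat) -> Prop :=
| sb_nil : same_blocks [] []
| sb_cons a a' P P' : same_blocks P P' ->
    same_blocks (map Some a ++ None :: P) (map Some a' ++ None :: P').

Lemma same_blocks_pop P P' R R' p p' :
  same_blocks P P' ->
  code p (nth 0 (P ++ R) None) = code p' (nth 0 (P' ++ R') None) ->
  (P = [] /\ P' = []) \/
  exists x x' P1 P1', P = x :: P1 /\ P' = x' :: P1' /\ same_blocks P1 P1'.
Proof.
  intros H E. destruct H as [|a a' P P' H]; [now left|right].
  destruct a as [|x a], a' as [|x' a']; simpl in E; try discriminate.
  - now exists None, None, P, P'.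
  - exists (Some x), (Some x'), (map Some a ++ None :: P), (map Some a' ++ None :: P').
    repeat split. now constructor.
Qed.

(** Equal codes at the top mean two markers or two scales, so removing both tops keeps the relation
    until both parts are exhausted together. [y] counts the removals that then reach into [R] and
    [R']. *)
Lemma same_blocks_pops q : forall P P' R R' p p',
  same_blocks P P' ->
  (forall i, (i < q)%nat -> code p (nth i (P ++ R) None) = code p' (nth i (P' ++ R') None)) ->
  exists y P1 P1',
    skipn q (P ++ R) = P1 ++ skipn y R /\ skipn q (P' ++ R') = P1' ++ skipn y R' /\
    same_blocks P1 P1' /\
    (forall x, (x < y)%nat -> code p (nth x R None) = code p' (nth x R' None)) /\
    (length P1' + q = length P' + y)%nat.
Proof.
  induction q as [|q IH]; intros P P' R R' p p' HP E.
  - exists 0%nat, P, P'. simpl. repeat split; auto; lia.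
  - destruct (same_blocks_pop _ _ R R' p p' HP (E 0%nat ltac:(lia)))
      as [[-> ->] | (x & x' & P1 & P1' & -> & -> & H1)].
    + exists (S q), [], []. simpl in *. repeat split; auto.
    + destruct (IH P1 P1' R R' p p' H1) as (y & P2 & P2' & A & B & C & D & F).
      * intros i Hi. exact (E (S i) ltac:(lia)).
      * exists y, P2, P2'. simpl. repeat split; auto; lia.
Qed.

Lemma end_time_ge b vs : increasing_from b vs -> (b <= end_time b vs)%nat.
Proof.
  revert b. induction vs as [|[s q] vs IH]; intros c H; unfold end_time; simpl in *; [lia|].
  fold (end_time (S s) vs). specialize (IH (S s) (proj2 H)). lia.
Qed.

(** A budget. The visits remove [Q * length vs] entries, while the second run pushes one entry per
    scale up to its end time and one marker per visit. If the removals exceed these pushes and [P']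
    by at least [X], the top [X] entries of [R] and [R'] are read, each pair in matching letters. *)
Lemma enc_sync_tail vs : forall vs' b b' P P' R R' X,
  same_blocks P P' ->
  enc (None :: P ++ R) b vs = enc (None :: P' ++ R') b' vs' ->
  increasing_from b' vs' ->
  (X + length P' + (end_time b' vs' - b') + length vs <= Q * length vs)%nat ->
  forall x, (x < X)%nat -> exists v v', In v vs /\ In v' vs' /\
    code (snd v) (nth x R None) = code (snd v') (nth x R' None).
Proof.
  induction vs as [|[t p] vs IH]; intros vs' b b' P P' R R' X HP E Hinc HX x Hx.
  - simpl in HX. lia.
  - destruct vs' as [|[t' p'] vs']; [discriminate|].
    simpl in E. injection E as E1 E2.
    replace (down t b ++ None :: P ++ R) with ((down t b ++ None :: P) ++ R) in *
      by (now rewrite <- app_assoc).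
    replace (down t' b' ++ None :: P' ++ R') with ((down t' b' ++ None :: P') ++ R') in *
      by (now rewrite <- app_assoc).
    destruct (same_blocks_pops Q (down t b ++ None :: P) (down t' b' ++ None :: P') R R' p p')
      as (y & P1 & P1' & A & B & C & D & F).
    { unfold down. now constructor. }
    { intros i Hi. now apply letter_eq. }
    destruct (lt_dec x y) as [Hy|Hy].
    { exists (t, p), (t', p'). simpl. auto. }
    rewrite length_app, down_length in F. cbn [length] in F.
    simpl in Hinc. destruct Hinc as [Hb Hinc]. simpl in HX. unfold end_time in HX. simpl in HX.
    rewrite A, B in E2.
    fold (end_time (S t') vs') in HX.
    pose proof (end_time_ge (S t') vs' Hinc).
    destruct (IH vs' (S t) (S t') P1 P1' (skipn y R) (skipn y R') (X - y)%nat C E2 Hinc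
      ltac:(lia) (x - y)%nat ltac:(lia)) as (v & v' & Hv & Hv' & G).
    exists v, v'. simpl. rewrite !nth_skipn in G.
    replace (y + (x - y))%nat with x in G by lia. auto.
Qed.

(* The last-in-first-out discipline keeps the two stacks aligned: two runs that wrote the
   same letters have compared the top entries of the stacks they started from. *)
Lemma enc_sync st st' b b' t p vs t' p' vs' X :
  enc st b ((t, p) :: vs) = enc st' b' ((t', p') :: vs') ->
  increasing_from (S t') vs' ->
  (X + (end_time (S t') vs' - S t') + length vs <= Q * S (length vs))%nat ->
  forall x, (x < X)%nat -> exists v v', In v ((t, p) :: vs) /\ In v' ((t', p') :: vs') /\
    code (snd v) (nth x (down t b ++ st) None) = code (snd v') (nth x (down t' b' ++ st') None).
Proof.
  intros E Hinc HX x Hx. simpl in E. injection E as E1 E2.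
  destruct (lt_dec x Q) as [Hq|Hq].
  - exists (t, p), (t', p'). simpl. repeat split; auto. now apply letter_eq.
  - destruct (enc_sync_tail vs vs' (S t) (S t') [] [] (skipn Q (down t b ++ st))
      (skipn Q (down t' b' ++ st')) (X - Q)%nat sb_nil E2 Hinc ltac:(simpl; lia)
      (x - Q)%nat ltac:(lia)) as (v & v' & Hv & Hv' & G).
    exists v, v'. simpl. rewrite !nth_skipn in G.
    replace (Q + (x - Q))%nat with x in G by lia. auto.
Qed.

Lemma end_time_le b vs e :
  (b <= e)%nat -> (forall v, In v vs -> (fst v < e)%nat) -> (end_time b vs <= e)%nat.
Proof.
  revert b. induction vs as [|[s q] vs IH]; intros b Hb H; unfold end_time; simpl; [lia|].
  fold (end_time (S s) vs). apply IH.
  - apply (H (s, q)). now left.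
  - intros v Hv. apply H. now right.
Qed.

(* Comparing the second segments bounds the lag between the first visits, the stamps then
   force the lag to vanish. *)
Lemma enc_sync_time st b t1 p1 t2 p2 vs t1' p1' t2' p2' vs' J N :
  nth 0 st None = None ->
  enc st b ((t1, p1) :: (t2, p2) :: vs) = enc st b ((t1', p1') :: (t2', p2') :: vs') ->
  increasing_from b ((t1, p1) :: (t2, p2) :: vs) ->
  increasing_from b ((t1', p1') :: (t2', p2') :: vs') ->
  (J <= t1')%nat -> (J <= t2)%nat ->
  (forall v, In v ((t1, p1) :: (t2, p2) :: vs) -> (fst v < J + N)%nat) ->
  (forall v, In v ((t1', p1') :: (t2', p2') :: vs') -> (fst v < J + N)%nat) ->
  (9 * N + 1 + N + S (length vs) <= Q * S (length vs))%nat ->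
  t1 = t1' /\
  forall x, (x < N)%nat -> exists v v', In v ((t1, p1) :: (t2, p2) :: vs) /\
    In v' ((t1', p1') :: (t2', p2') :: vs') /\
    code (snd v) (nth x (down t1 b ++ st) None) = code (snd v') (nth x (down t1 b ++ st) None).
Proof.
  intros Hst E Hi Hi' HJ1 HJ2 HN HN' HQ.
  assert (Ht1 : (t1 < J + N)%nat) by (apply (HN (t1, p1)); simpl; auto).
  assert (Ht2 : (t2 < J + N)%nat) by (apply (HN (t2, p2)); simpl; auto).
  assert (Ht1' : (t1' < J + N)%nat) by (apply (HN' (t1', p1')); simpl; auto).
  assert (Ht2' : (t2' < J + N)%nat) by (apply (HN' (t2', p2')); simpl; auto).
  destruct Hi as (Hb1 & Hb2 & Hi). destruct Hi' as (Hb1' & Hb2' & Hi').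
  assert (He2 : (end_time (S t2') vs' <= J + N)%nat).
  { apply end_time_le; [lia|]. intros v Hv. apply HN'. simpl; auto. }
  (* From the second letter on, the stacks are compared down to depth [N]. At depth [t2' - t1'],
     which is below [N], the second run shows the marker of its first visit; a gap longer than [N]
     in the first run would show a scale there. *)
  assert (Hgap : (t2 - t1 <= N)%nat).
  { pose proof E as E'. cbn [enc] in E'.
    assert (E2 : enc (None :: skipn Q (down t1 b ++ st)) (S t1) ((t2, p2) :: vs) =
                 enc (None :: skipn Q (down t1' b ++ st)) (S t1') ((t2', p2') :: vs'))
      by (injection E' as _ E2 E3; cbn [enc]; now rewrite E2, E3).
    destruct (enc_sync _ _ _ _ _ _ _ _ _ _ (N + 1) E2 Hi' ltac:(lia) (t2' - t1')%nat ltac:(lia))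
      as (v & v' & _ & _ & G).
    apply code_None in G.
    destruct (le_dec (t2 - t1) N) as [|Hn]; [assumption|exfalso].
    assert (A : nth (t2' - t1') (down t2' (S t1') ++ None :: skipn Q (down t1' b ++ st)) None = None).
    { apply nth_down_bottom; [reflexivity|lia]. }
    apply G in A. rewrite nth_down in A by lia. discriminate. }
  (* Both first visits now lie between [J - N] and [J + N], so their lag is below [2 * N] and a
     window of fewer than [8 * N] scales contains two stamps that differ by this lag. *)
  assert (Hcmp := enc_sync _ _ _ _ _ _ _ _ _ _ (8 * N + 2) E (conj Hb2' Hi')).
  assert (Hend : (end_time (S t1') ((t2', p2') :: vs') <= J + N)%nat).
  { unfold end_time. simpl. exact He2. }
  cbn [length] in Hcmp.
  assert (Hpre : (8 * N + 2 + (end_time (S t1') ((t2', p2') :: vs') - S t1') + S (length vs)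
             <= Q * S (S (length vs)))%nat) by lia.
  specialize (Hcmp Hpre). clear Hpre.
  (* If the run that starts earlier reaches the bottom [b] within the compared depth, its [None]
     there meets a scale of the other run. Otherwise a whole window of stamps would agree with its
     shift by the lag. *)
  assert (Heq : t1 = t1').
  { destruct (lt_eq_lt_dec t1 t1') as [[Hlt|]|Hgt]; [exfalso|assumption|exfalso].
    - destruct (lt_dec (S t1 - b) (8 * N + 2)) as [Hs|Hs].
      + destruct (Hcmp _ Hs) as (v & v' & _ & _ & G). apply code_None in G.
        assert (A := proj1 G (nth_down_bottom _ _ _ _ Hst eq_refl)).
        rewrite nth_down in A by lia. discriminate.
      + destruct (stamp_aperiodic (t1' - t1) (S t1 - (8 * N + 2))%nat ltac:(lia)) as (s & Hs' & Hne).
        apply Hne. destruct (Hcmp (t1 - s)%nat ltac:(lia)) as (v & v' & _ & _ & G).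
        rewrite !nth_down in G by lia. apply code_Some in G.
        replace (t1 - (t1 - s))%nat with s in G by lia.
        replace (t1' - (t1 - s))%nat with (s + (t1' - t1))%nat in G by lia. apply G.
    - destruct (lt_dec (S t1' - b) (8 * N + 2)) as [Hs|Hs].
      + destruct (Hcmp _ Hs) as (v & v' & _ & _ & G). apply code_None in G.
        assert (A := proj2 G (nth_down_bottom _ _ _ _ Hst eq_refl)).
        rewrite nth_down in A by lia. discriminate.
      + destruct (stamp_aperiodic (t1 - t1') (S t1' - (8 * N + 2))%nat ltac:(lia)) as (s & Hs' & Hne).
        apply Hne. destruct (Hcmp (t1' - s)%nat ltac:(lia)) as (v & v' & _ & _ & G).
        rewrite !nth_down in G by lia. apply code_Some in G.
        replace (t1' - (t1' - s))%nat with s in G by lia.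
        replace (t1 - (t1' - s))%nat with (s + (t1 - t1'))%nat in G by lia. symmetry; apply G. }
  split; [exact Heq|]. subst t1'. intros x Hx. apply Hcmp. lia.
Qed.

End Diary.

(** * Words as vertices of the binary tree *)

Lemma lcp_len_app (x u v : list nat) : lcp_len (x ++ u) (x ++ v) = (length x + lcp_len u v)%nat.
Proof. induction x as [|a x IH]; simpl; [reflexivity|]. now rewrite Nat.eqb_refl, IH. Qed.

Lemma lcp_len_le (u v : list nat) : (lcp_len u v <= length u)%nat /\ (lcp_len u v <= length v)%nat.
Proof.
  revert v. induction u as [|a u IH]; intros [|b v]; simpl; try lia.
  destruct (Nat.eqb a b); [|lia]. specialize (IH v). lia.
Qed.

Lemma lcp_len_neq (x y u v : list nat) :
  length x = length y -> x <> y -> (lcp_len (x ++ u) (y ++ v) < length x)%nat.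
Proof.
  revert y. induction x as [|a x IH]; intros [|b y] Hl Hn; simpl in *; try discriminate.
  - now contradict Hn.
  - destruct (Nat.eqb_spec a b) as [->|]; [|lia].
    assert (x <> y) by congruence. specialize (IH y ltac:(lia) H). lia.
Qed.

Section Bits.

Variables Q B : nat.

(** A code of constant length [B]: each letter occupies exactly [Q * B] bits, and depth in the tree
    is proportional to the length of the word. *)
Definition onehot (a : nat) : list nat :=
  map (fun i => if Nat.eqb i a then 1%nat else 0%nat) (seq 0 B).

Definition bits (w : list (list nat)) : list nat := flat_map (flat_map onehot) w.

Definition good_letter (l : list nat) : Prop := length l = Q /\ Forall (fun a => (a < B)%nat) l.

Lemma onehot_length a : length (onehot a) = B.
Proof. unfold onehot. now rewrite length_map, length_seq. Qed.

Lemma onehot_inj a b : (a < B)%nat -> onehot a = onehot b -> a = b.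
Proof.
  intros Ha H. assert (E := proj1 map_ext_in_iff H a). simpl in E.
  rewrite Nat.eqb_refl in E. destruct (Nat.eqb_spec a b); [assumption|].
  specialize (E ltac:(apply in_seq; lia)). discriminate.
Qed.

Lemma flat_onehot_length l : length (flat_map onehot l) = (length l * B)%nat.
Proof.
  induction l as [|a l IH]; simpl; [reflexivity|]. now rewrite length_app, IH, onehot_length.
Qed.

Lemma flat_onehot_inj l l' :
  length l = length l' -> Forall (fun a => (a < B)%nat) l ->
  flat_map onehot l = flat_map onehot l' -> l = l'.
Proof.
  revert l'. induction l as [|a l IH]; intros [|b l'] Hl HF H; simpl in *; try discriminate; auto.
  inversion HF; subst. apply app_eq_length in H; [|now rewrite !onehot_length].
  destruct H as [E1 E2]. apply onehot_inj in E1; auto. subst. f_equal. apply IH; auto; lia.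
Qed.

Lemma bits_length w : Forall good_letter w -> length (bits w) = (length w * (Q * B))%nat.
Proof.
  induction 1 as [|l w [Hl _] _ IH]; simpl; [reflexivity|].
  unfold bits in *. simpl. rewrite length_app, IH, flat_onehot_length, Hl. lia.
Qed.

Lemma bits_app w w' : bits (w ++ w') = bits w ++ bits w'.
Proof. apply flat_map_app. Qed.

Lemma bits_binary w : Forall (fun b => (b < 2)%nat) (bits w).
Proof.
  apply Forall_flat_map, Forall_forall. intros l _.
  apply Forall_flat_map, Forall_forall. intros a _.
  apply Forall_map, Forall_forall. intros i _. destruct (Nat.eqb i a); lia.
Qed.

(** The entries 0 and 1 are allowed at every position; the third branch at the root stays empty. *)
Lemma binary_vertex_ok (v : list nat) :
  Forall (fun b => (b < 2)%nat) v -> tree_point_ok (v, INR (length v)).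
Proof.
  intro H. split; simpl.
  - destruct v as [|a v]; simpl; [exact I|]. inversion H; subst. split; [lia|assumption].
  - destruct v as [|a v]; [left; split; reflexivity|right]. split; [discriminate|lra].
Qed.

Definition vertex (w : list (list nat)) : BTree :=
  exist _ (bits w, INR (length (bits w))) (binary_vertex_ok _ (bits_binary w)).

Lemma tree_dist_vertex w w' :
  tree_dist (vertex w) (vertex w') =
  INR (length (bits w)) + INR (length (bits w')) - 2 * INR (lcp_len (bits w) (bits w')).
Proof.
  unfold tree_dist. simpl. destruct (lcp_len_le (bits w) (bits w')) as [H1 H2].
  apply le_INR in H1, H2. rewrite Rmin_left; [reflexivity|]. now apply Rmin_glb.
Qed.

Lemma tree_dist_vertex_le w u v :
  Forall good_letter (w ++ u) -> Forall good_letter (w ++ v) ->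
  tree_dist (vertex (w ++ u)) (vertex (w ++ v)) <= INR (Q * B) * (INR (length u) + INR (length v)).
Proof.
  intros Hu Hv. apply Forall_app in Hu, Hv. destruct Hu as [Hw Hu], Hv as [_ Hv].
  rewrite tree_dist_vertex, !bits_app, lcp_len_app, !length_app, !bits_length by assumption.
  rewrite !plus_INR, !mult_INR. pose proof (pos_INR (lcp_len (bits u) (bits v))). lra.
Qed.

Lemma tree_dist_vertex_length u v :
  Forall good_letter u -> Forall good_letter v ->
  INR (Q * B) * (INR (length u) - INR (length v)) <= tree_dist (vertex u) (vertex v).
Proof.
  intros Hu Hv. rewrite tree_dist_vertex.
  destruct (lcp_len_le (bits u) (bits v)) as [_ H]. apply le_INR in H.
  rewrite !bits_length in * by assumption. rewrite !mult_INR in *. lra.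
Qed.

(** Beyond [w] the bit strings agree at most inside the first differing letter, that is on at most
    [Q * B] bits. This length is subtracted twice in the distance, whence the loss of 2. *)
Lemma tree_dist_vertex_ge u v :
  Forall good_letter u -> Forall good_letter v -> exists w u' v', u = w ++ u' /\ v = w ++ v' /\
  INR (Q * B) * (INR (length u') + INR (length v') - 2) <= tree_dist (vertex u) (vertex v).
Proof.
  intros Hu Hv. destruct (common_prefix u v) as (w & u' & v' & -> & -> & H).
  exists w, u', v'. repeat split. apply Forall_app in Hu, Hv.
  destruct Hu as [Hw Hu], Hv as [_ Hv].
  rewrite tree_dist_vertex, !bits_app, lcp_len_app, !length_app, !plus_INR.
  assert (Hl : INR (lcp_len (bits u') (bits v')) <= INR (Q * B)).
  { apply le_INR. destruct (lcp_len_le (bits u') (bits v')) as [H1 H2].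
    destruct H as [-> | [-> | (a & b & u2 & v2 & -> & -> & Hn)]]; simpl in *; try lia.
    unfold bits. simpl. inversion Hu as [|? ? [Ha Ha'] _]; inversion Hv as [|? ? [Hb Hb'] _]; subst.
    assert (L : length (flat_map onehot a) = (length a * B)%nat) by apply flat_onehot_length.
    assert (L' : length (flat_map onehot b) = (length b * B)%nat) by apply flat_onehot_length.
    pose proof (lcp_len_neq (flat_map onehot a) (flat_map onehot b)
      (flat_map (flat_map onehot) u2) (flat_map (flat_map onehot) v2)) as N.
    rewrite L, L' in N. rewrite Ha, Hb in N. specialize (N eq_refl).
    assert (flat_map onehot a <> flat_map onehot b).
    { intro E. apply Hn. apply flat_onehot_inj; auto; congruence. }
    specialize (N H). lia. }
  rewrite (bits_length u'), (bits_length v') by assumption. rewrite !(mult_INR (length _)).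
  lra.
Qed.

Lemma tree_dist_vertex_sym u v : tree_dist (vertex u) (vertex v) = tree_dist (vertex v) (vertex u).
Proof.
  rewrite !tree_dist_vertex.
  assert (S : forall x y, lcp_len x y = lcp_len y x).
  { induction x as [|a x IH]; intros [|b y]; simpl; auto. rewrite Nat.eqb_sym, IH. reflexivity. }
  rewrite S. lra.
Qed.

End Bits.

(** * Distances between diaries *)

Section Visits.

Variable T : Type.

Definition visits (f : nat -> option T) (a k : nat) : list (nat * T) :=
  flat_map (fun t => match f t with Some p => [(t, p)] | None => [] end) (seq a k).

Lemma visits_add f a k k' : visits f a (k + k') = visits f a k ++ visits f (a + k) k'.
Proof. unfold visits. now rewrite seq_app, flat_map_app. Qed.

Lemma visits_split f k k' :
  (k <= k')%nat -> visits f 0 k' = visits f 0 k ++ visits f k (k' - k).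
Proof. intro H. rewrite <- (visits_add f 0 k). f_equal. lia. Qed.

Lemma visits_ext f f' a k :
  (forall s, (a <= s < a + k)%nat -> f s = f' s) -> visits f a k = visits f' a k.
Proof.
  revert a. induction k as [|k IH]; intros a H; [reflexivity|].
  unfold visits. simpl. rewrite (H a) by lia. f_equal. apply IH. intros s Hs. apply H. lia.
Qed.

Lemma visits_none f a k :
  (forall s, (a <= s < a + k)%nat -> f s = None) -> visits f a k = [].
Proof.
  revert a. induction k as [|k IH]; intros a H; [reflexivity|].
  unfold visits. simpl. rewrite (H a) by lia. apply IH. intros s Hs. apply H. lia.
Qed.

Lemma visits_In f a k v : In v (visits f a k) -> (a <= fst v < a + k)%nat /\ f (fst v) = Some (snd v).
Proof.
  unfold visits. intro H. apply in_flat_map in H. destruct H as (t & Ht & H).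
  apply in_seq in Ht. destruct (f t) eqn:E; [|destruct H].
  destruct H as [<- | []]. simpl. auto.
Qed.

Lemma visits_increasing f a k : increasing_from T a (visits f a k).
Proof.
  assert (G : forall k a b, (b <= a)%nat -> increasing_from T b (visits f a k)).
  { clear. induction k as [|k IH]; intros a b H; [exact I|].
    unfold visits. simpl. destruct (f a); simpl.
    - split; [exact H|]. apply IH. lia.
    - apply IH. lia. }
  now apply G.
Qed.

Lemma visits_length_le f a k : (length (visits f a k) <= k)%nat.
Proof.
  revert a. induction k as [|k IH]; intros a; [apply le_n|].
  unfold visits. simpl. rewrite length_app. specialize (IH (S a)). unfold visits in IH.
  destruct (f a); simpl; lia.
Qed.

Lemma increasing_from_firstn h b vs : increasing_from T b vs -> increasing_from T b (firstn h vs).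
Proof.
  revert b vs. induction h as [|h IH]; intros b [|[t p] vs] H; simpl in *; auto.
  destruct H. auto.
Qed.

Lemma increasing_from_ge b vs v : increasing_from T b vs -> In v vs -> (b <= fst v)%nat.
Proof.
  revert b. induction vs as [|[t p] vs IH]; intros b H Hv; [destruct Hv|].
  destruct H as [Hb H]. destruct Hv as [<- | Hv]; [exact Hb|].
  specialize (IH _ H Hv). lia.
Qed.

Lemma enc_firstn Q label h st b (vs : list (nat * T)) :
  firstn h (enc T Q label st b vs) = enc T Q label st b (firstn h vs).
Proof.
  revert st b vs. induction h as [|h IH]; intros st b [|[t p] vs]; simpl; auto.
  now rewrite IH.
Qed.

(** Past visits influence later letters only through the stack and the clock, so two points with the
    same initial visits share these letters and continue from the same state. *)
Lemma enc_app Q label us : forall st b, nth 0 st None = None ->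
  exists st', nth 0 st' None = None /\ forall vs : list (nat * T),
    enc T Q label st b (us ++ vs) = enc T Q label st b us ++ enc T Q label st' (end_time T b us) vs.
Proof.
  induction us as [|[t p] us IH]; intros st b Hst.
  - exists st. auto.
  - destruct (IH (None :: skipn Q (down t b ++ st)) (S t) eq_refl) as (st' & H1 & H2).
    exists st'. split; [exact H1|]. intro vs. simpl. now rewrite H2.
Qed.

Lemma end_time_visits f b :
  (b = 0%nat \/ f (b - 1)%nat <> None) -> end_time T 0 (visits f 0 b) = b.
Proof.
  intros [-> | H]; [reflexivity|]. destruct b as [|b]; [reflexivity|].
  replace (S b) with (b + 1)%nat by lia. rewrite visits_add. unfold end_time.
  rewrite fold_left_app. unfold visits at 1. simpl. simpl in H. rewrite Nat.sub_0_r in H.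
  destruct (f b) eqn:E; [simpl; lia|now contradict H].
Qed.

Lemma letter_good Q M label p st :
  (forall s, (label s p < M)%nat) -> good_letter Q (2 * M + 2) (letter T Q label p st).
Proof.
  intro H. split.
  - unfold letter. now rewrite length_map, length_seq.
  - unfold letter. apply Forall_map, Forall_forall. intros i _.
    destruct (nth i st None) as [s|]; simpl; [|lia].
    specialize (H s). destruct (stamp s); simpl; lia.
Qed.

Lemma enc_good Q M label st b (vs : list (nat * T)) :
  (forall s p, (label s p < M)%nat) -> Forall (good_letter Q (2 * M + 2)) (enc T Q label st b vs).
Proof.
  intro H. revert st b. induction vs as [|[t p] vs IH]; intros st b; simpl; constructor; auto.
  now apply letter_good.
Qed.

End Visits.

(** * Two-sided bounds for the words of a laminar system of names *)

Section Separation.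

Variables (T : Type) (d : T -> T -> R) (n : nat) (tau : nat -> R) (theta : R).
Variables (m : nat -> T -> nat -> option T) (label : nat -> T -> nat).

Hypothesis d_metric : is_metric d.
Hypothesis tau_pos : forall t, 0 < tau t.
Hypothesis theta_pos : 0 < theta.
Hypothesis theta_le1 : theta <= 1.
Hypothesis tau_ratio : forall t, 5 * tau (S t) <= theta * tau t.

(* [m c z t] names the member of the colour-[c], scale-[t] family that contains [z], by a
   chosen point of that member. *)
Hypothesis m_close : forall c z t p, m c z t = Some p -> d z p <= 2 * tau t.
Hypothesis m_cover : forall z t, exists c, (c <= n)%nat /\ m c z t <> None.
Hypothesis m_same_level : forall c z z' t p p', m c z t = Some p -> m c z' t = Some p' ->
  d z z' < theta * tau t -> p = p'.
Hypothesis m_exit : forall c z z' t s p, m c z t = Some p -> m c z' t <> Some p ->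
  (t < s)%nat -> d z z' < theta * tau s -> m c z s = None /\ m c z' s = None.
Hypothesis m_nested : forall c z z' t s p, m c z t = Some p -> m c z' t = Some p ->
  (s < t)%nat -> m c z s = m c z' s.
Hypothesis m_separated : forall c z z' t p p', m c z t = Some p -> m c z' t = Some p' ->
  p <> p' -> theta * tau t <= d p p'.
Hypothesis label_separates : forall s p p', theta * tau s <= d p p' ->
  (s <= 1)%nat \/ d p p' <= 5 * tau (s - 2) -> label s p <> label s p'.

(** The factor [20 * (n + 1)] makes the letters shared after separation, in one colour, at most a
    fraction [1 / (2 * (n + 1))] of the scales up to a constant, hence about half of them over all
    colours. The extra 1 pays for the marker pushed at each visit. *)
Let Q := (20 * (n + 1) + 1)%nat.

Definition word (c : nat) (z : T) (k : nat) : list (list nat) :=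
  enc T Q label [] 0 (visits T (m c z) 0 k).

Lemma tau_antitone s t : (s <= t)%nat -> tau t <= tau s.
Proof.
  induction 1 as [|t H IH]; [lra|].
  pose proof (tau_ratio t). pose proof (tau_pos t). pose proof (tau_pos (S t)). nra.
Qed.

(** At the first disagreement only one of the two points is visited, since [m_same_level] excludes
    two distinct names. By [m_exit] neither point is visited at the later scales below [k]. *)
Lemma visits_agree c z z' k :
  (forall t, (t < k)%nat -> d z z' < theta * tau t) ->
  exists us e e', visits T (m c z) 0 k = us ++ e /\ visits T (m c z') 0 k = us ++ e' /\
    (length e + length e' <= 1)%nat.
Proof.
  intro H. destruct (first_before (fun t => m c z t <> m c z' t) k) as [(t & Ht & Hd & Hs) | Hs].
  - assert (Hs' : visits T (m c z) 0 t = visits T (m c z') 0 t).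
    { apply visits_ext. intros s Hst. apply NNPP. apply Hs. lia. }
    assert (G : forall f, (forall s, (t < s < k)%nat -> f s = None) ->
      visits T f 0 k = visits T f 0 t ++ visits T f t 1).
    { intros f Hf. replace k with (t + (1 + (k - t - 1)))%nat at 1 by lia.
      rewrite !visits_add. rewrite (visits_none T f (0 + t + 1)) by (intros; apply Hf; lia).
      now rewrite app_nil_r. }
    destruct (m c z t) as [p|] eqn:E, (m c z' t) as [p'|] eqn:E'.
    + exfalso. apply Hd. f_equal. eapply m_same_level; eauto.
    + assert (N : forall s, (t < s < k)%nat -> m c z s = None /\ m c z' s = None).
      { intros s Hts. apply (m_exit c z z' t s p); [exact E|congruence|lia|apply H; lia]. }
      rewrite !G by (intros; now apply N). rewrite Hs'.
      eexists _, _, _. split; [reflexivity|]. split; [reflexivity|].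
      unfold visits; simpl. rewrite E, E'. simpl. lia.
    + assert (N : forall s, (t < s < k)%nat -> m c z' s = None /\ m c z s = None).
      { intros s Hts. apply (m_exit c z' z t s p'); [exact E'|congruence|lia|].
        destruct d_metric as (_ & _ & Hsym & _). rewrite Hsym. apply H; lia. }
      rewrite !G by (intros; now apply N). rewrite Hs'.
      eexists _, _, _. split; [reflexivity|]. split; [reflexivity|].
      unfold visits; simpl. rewrite E, E'. simpl. lia.
    + now contradict Hd.
  - exists (visits T (m c z) 0 k), [], []. rewrite !app_nil_r. repeat split; [|simpl; lia].
    apply visits_ext. intros s Hst. symmetry. apply NNPP. apply Hs. lia.
Qed.

(** Supplies the upper bound for [label_separates]: [d p p'] is at most
    [4 * tau J + theta * tau (J - 1)], hence at most [5 * tau (J - 1)], and [s - 2 <= J - 1]. *)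
Lemma label_close_points s J z z' p p' :
  (J <= s <= J + 1)%nat -> (forall t, (t < J)%nat -> d z z' < theta * tau t) ->
  d z p <= 2 * tau J -> d z' p' <= 2 * tau J -> theta * tau s <= d p p' ->
  label s p <> label s p'.
Proof.
  intros Hs Hn Hp Hp' Hl. apply label_separates; [exact Hl|].
  destruct (le_lt_dec s 1) as [|H1]; [now left|right].
  destruct d_metric as (_ & _ & Hsym & Htri).
  assert (A : d p p' <= d z p + d z z' + d z' p').
  { pose proof (Htri p z p'). pose proof (Htri z z' p'). rewrite (Hsym p z) in *. lra. }
  specialize (Hn (J - 1)%nat ltac:(lia)).
  pose proof (tau_antitone (s - 2) (J - 1) ltac:(lia)).
  assert (5 * tau J <= theta * tau (J - 1)).
  { replace J with (S (J - 1)) at 1 by lia. apply tau_ratio. }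
  pose proof (tau_pos (J - 1)). pose proof (tau_pos (s - 2)). nra.
Qed.

(* The initial stack and the time [b] are those left by the common visits. *)
Lemma diary_separates c z z' J N b st vs vs' :
  (forall t, (t < J)%nat -> d z z' < theta * tau t) -> theta * tau J <= d z z' ->
  (b <= J + 1)%nat ->
  (forall s p, (b <= s)%nat -> m c z s = Some p -> m c z' s <> Some p) ->
  nth 0 st None = None ->
  enc T Q label st b vs = enc T Q label st b vs' ->
  increasing_from T b vs -> increasing_from T b vs' ->
  (forall v, In v vs -> (fst v < J + N)%nat /\ m c z (fst v) = Some (snd v)) ->
  (forall v, In v vs' -> (J <= fst v < J + N)%nat /\ m c z' (fst v) = Some (snd v)) ->
  (2 <= length vs)%nat ->
  (20 * (n + 1) * (length vs - 1) <= 10 * N)%nat.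
Proof.
  intros Hnear Hfar Hb Hnc Hst E Hi Hi' Hv Hv' Hlen.
  destruct (le_lt_dec (20 * (n + 1) * (length vs - 1)) (10 * N)) as [|HQ]; [assumption|exfalso].
  assert (Hlen' : length vs = length vs').
  { apply (f_equal (@length _)) in E. now rewrite !enc_length in E. }
  destruct vs as [|[t1 p1] [|[t2 p2] vs]]; [simpl in Hlen; lia|simpl in Hlen; lia|].
  destruct vs' as [|[t1' p1'] [|[t2' p2'] vs']]; [simpl in Hlen'; lia|simpl in Hlen'; lia|].
  destruct (Hv (t1, p1) (or_introl eq_refl)) as [_ M1].
  destruct (Hv (t2, p2) (or_intror (or_introl eq_refl))) as [_ M2].
  destruct (Hv' (t1', p1') (or_introl eq_refl)) as [B1' M1'].
  cbn [fst snd] in *.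
  (* Before scale [J] the points are close, so after the visit at [t1], whose member does not
     contain [z'], [m_exit] forbids another visit of [z]. *)
  assert (Ht2 : (J <= t2)%nat).
  { destruct (le_lt_dec J t2) as [|Hlt]; [assumption|exfalso].
    destruct Hi as (H1 & H2 & _).
    destruct (m_exit c z z' t1 t2 p1 M1 (Hnc _ _ H1 M1) H2 (Hnear _ Hlt)) as [F _]. congruence. }
  destruct (enc_sync_time T Q label st b t1 p1 t2 p2 vs t1' p1' t2' p2' vs' J N Hst E Hi Hi'
    ltac:(lia) Ht2) as [Heq Hcmp].
  { intros v Hin. now apply Hv. }
  { intros v Hin. now apply Hv'. }
  { cbn [length] in HQ. replace (S (S (length vs)) - 1)%nat with (S (length vs)) in HQ by lia.
    unfold Q. nia. }
  (* If the common first visit is at [J], the first entry of both first letters is the label at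
     scale [J] of two distinct names at that scale. *)
  subst t1'. destruct (Nat.eq_dec t1 J) as [->|HJ].
  - assert (G : label J p1 = label J p1').
    { cbn [enc] in E. injection E as E1 _ _.
      pose proof (letter_eq T Q label p1 p1' _ _ 0 E1 ltac:(unfold Q; lia)) as C.
      destruct Hi as [Hb1 _]. rewrite !nth_down in C by lia. apply code_Some in C.
      rewrite Nat.sub_0_r in C. apply C. }
    revert G. apply (label_close_points J J z z'); auto; try lia.
    + now apply (m_close c).
    + now apply (m_close c).
    + apply (m_separated c z z' J); auto. intros <-. destruct Hi as [Hb1 _]. now apply (Hnc J p1).
  (* If it is later, the entry for scale [J + 1] is compared. The visiting names are within
     [2 * tau (J + 1)] of [z] and [z'], hence still at least [theta * tau (J + 1)] apart; at scale
     [J] this lower bound could fail. *)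
  - destruct (Hcmp (t1 - (J + 1))%nat ltac:(lia)) as (v & v' & I1 & I1' & C).
    rewrite !nth_down in C by lia. apply code_Some in C. destruct C as [C _].
    replace (t1 - (t1 - (J + 1)))%nat with (S J) in C by lia.
    destruct (Hv v I1) as [_ Mv]. destruct (Hv' v' I1') as [_ Mv'].
    assert (L : (t1 <= fst v)%nat).
    { destruct I1 as [<- | I1]; [simpl; lia|]. destruct Hi as [_ Hi].
      pose proof (increasing_from_ge T _ _ _ Hi I1). lia. }
    assert (L' : (t1 <= fst v')%nat).
    { destruct I1' as [<- | I1']; [simpl; lia|]. destruct Hi' as [_ Hi'].
      pose proof (increasing_from_ge T _ _ _ Hi' I1'). lia. }
    pose proof (m_close _ _ _ _ Mv) as D. pose proof (m_close _ _ _ _ Mv') as D'.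
    pose proof (tau_antitone (S J) (fst v) ltac:(lia)). pose proof (tau_antitone (S J) (fst v') ltac:(lia)).
    pose proof (tau_antitone J (S J) ltac:(lia)).
    revert C. apply (label_close_points (S J) J z z'); auto; try lia; try lra.
    destruct d_metric as (_ & _ & Hsym & Htri).
    pose proof (Htri z (snd v) z'). pose proof (Htri (snd v) (snd v') z').
    rewrite (Hsym (snd v') z') in *. pose proof (tau_ratio J). pose proof (tau_pos (S J)). nra.
Qed.

(** A common prefix consists of the letters of the visits shared by both points, at most one more
    than the visits before [J], and of a part bounded by [diary_separates]. *)
Lemma common_word_bound c z z' J k l w u v :
  (forall t, (t < J)%nat -> d z z' < theta * tau t) -> theta * tau J <= d z z' ->
  (J < l)%nat -> (l <= k)%nat ->
  word c z k = w ++ u -> word c z' l = w ++ v ->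
  (2 * (n + 1) * length w <= 2 * (n + 1) * (length (visits T (m c z) 0 J) + 2) + (k - J))%nat.
Proof.
  intros Hnear Hfar HJl Hlk Hw Hw'.
  destruct d_metric as (_ & _ & Hsym & Htri).
  assert (Hcommon : forall t p, m c z t = Some p -> m c z' t = Some p -> (t <= J)%nat).
  { intros t p E E'. destruct (le_lt_dec t J) as [|Hlt]; [assumption|exfalso].
    apply m_close in E, E'. pose proof (Htri z p z'). rewrite (Hsym p z') in *.
    pose proof (tau_antitone (S J) t Hlt). pose proof (tau_ratio J). pose proof (tau_pos (S J)). nra. }
  (* [b] follows the last scale at which the two points have the same name. By [m_nested] all
     earlier visits agree too. *)
  assert (Hb : exists b, (b <= J + 1)%nat /\ visits T (m c z) 0 b = visits T (m c z') 0 b /\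
    (b = 0%nat \/ m c z (b - 1)%nat <> None) /\
    (forall s p, (b <= s)%nat -> m c z s = Some p -> m c z' s <> Some p)).
  { destruct (last_before (fun t => exists p, m c z t = Some p /\ m c z' t = Some p) (J + 1))
      as [(t & Ht & (p & E & E') & Hl) | Hl].
    - exists (S t). split; [lia|]. split; [|split].
      + apply visits_ext. intros s Hs. destruct (Nat.eq_dec s t) as [->|]; [congruence|].
        apply (m_nested c z z' t s p); auto. lia.
      + right. simpl. rewrite Nat.sub_0_r. congruence.
      + intros s q Hs F F'. pose proof (Hcommon _ _ F F'). apply (Hl s); [lia|]. eauto.
    - exists 0%nat. split; [lia|]. split; [reflexivity|]. split; [now left|].
      intros s q Hs F F'. pose proof (Hcommon _ _ F F'). apply (Hl s); [lia|]. eauto. }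
  destruct Hb as (b & HbJ & Hus & Hend & Hnc).
  set (us := visits T (m c z) 0 b) in *.
  assert (Hbase : (length us <= length (visits T (m c z) 0 J) + 1)%nat).
  { unfold us. destruct (le_lt_dec b J) as [Hle|].
    - rewrite (visits_split T _ b J), length_app by lia. lia.
    - replace b with (J + 1)%nat by lia. rewrite visits_add, length_app.
      pose proof (visits_length_le T (m c z) (0 + J) 1). lia. }
  destruct (enc_app T Q label us [] 0 eq_refl) as (st & Hst & Henc).
  assert (Het : end_time T 0 us = b) by (now apply end_time_visits).
  rewrite Het in Henc.
  assert (Hz : word c z k = enc T Q label [] 0 us ++ enc T Q label st b (visits T (m c z) b (k - b))).
  { unfold word. rewrite (visits_split T _ b k) by lia. apply Henc. }
  assert (Hz' : word c z' l = enc T Q label [] 0 us ++ enc T Q label st b (visits T (m c z') b (l - b))).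
  { unfold word. rewrite (visits_split T _ b l), <- Hus by lia. apply Henc. }
  destruct (le_lt_dec (length w) (length us + 1)) as [Hshort|Hlong]; [nia|].
  set (h := (length w - length us)%nat).
  assert (Hpre : forall x r, w ++ x = enc T Q label [] 0 us ++ r ->
    skipn (length us) w = firstn h r).
  { intros x r Eq. unfold h.
    apply (f_equal (fun y => firstn (length w - length us) (skipn (length us) y))) in Eq.
    rewrite !skipn_app, enc_length, Nat.sub_diag in Eq.
    rewrite (skipn_all2 (enc T Q label [] 0 us)) in Eq by (rewrite enc_length; lia).
    rewrite firstn_app, length_skipn, Nat.sub_diag in Eq. cbn [firstn skipn app] in Eq.
    rewrite app_nil_r in Eq. rewrite firstn_all2 in Eq by (rewrite length_skipn; lia). exact Eq. }
  pose proof (Hpre u _ (eq_trans (eq_sym Hw) Hz)) as P1.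
  pose proof (Hpre v _ (eq_trans (eq_sym Hw') Hz')) as P2.
  rewrite enc_firstn in P1, P2. rewrite P1 in P2.
  set (vs := firstn h (visits T (m c z) b (k - b))) in *.
  set (vs' := firstn h (visits T (m c z') b (l - b))) in *.
  assert (Hlen : length vs = h).
  { apply (f_equal (@length _)) in P1. rewrite enc_length, length_skipn in P1. unfold h. lia. }
  assert (Hlen' : length vs' = h).
  { apply (f_equal (@length _)) in P2. rewrite !enc_length in P2. lia. }
  assert (Hi : increasing_from T b vs) by (apply increasing_from_firstn, visits_increasing).
  assert (Hi' : increasing_from T b vs') by (apply increasing_from_firstn, visits_increasing).
  assert (Hin : forall x, In x vs -> (b <= fst x < J + (k - J))%nat /\ m c z (fst x) = Some (snd x)).
  { intros x Hx. assert (Hx' : In x (visits T (m c z) b (k - b))).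
    { rewrite <- (firstn_skipn h). apply in_or_app. now left. }
    apply visits_In in Hx'. split; [lia|apply Hx']. }
  assert (Hin' : forall x, In x vs' -> (b <= fst x < J + (k - J))%nat /\ m c z' (fst x) = Some (snd x)).
  { intros x Hx. assert (Hx' : In x (visits T (m c z') b (l - b))).
    { rewrite <- (firstn_skipn h). apply in_or_app. now left. }
    apply visits_In in Hx'. split; [lia|apply Hx']. }
  (* After [b] at most one of the two points is visited before [J]: an earlier visit of one
     excludes, by [m_exit], a later one of the other, and simultaneous visits would share a name.
     The roles are exchanged if that point is [z']. *)
  assert (Hmain : (20 * (n + 1) * (h - 1) <= 10 * (k - J))%nat).
  { destruct (classic (forall x, In x vs' -> (J <= fst x)%nat)) as [Hlate|Hearly].
    - rewrite <- Hlen. apply (diary_separates c z z' J (k - J) b st vs vs'); auto.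
      + intros x Hx. specialize (Hin x Hx). split; [lia|apply Hin].
      + intros x Hx. specialize (Hin' x Hx). specialize (Hlate x Hx). split; [lia|apply Hin'].
      + lia.
    - rewrite <- Hlen'. apply (diary_separates c z' z J (k - J) b st vs' vs); auto.
      + intros t Ht. rewrite Hsym. auto.
      + rewrite Hsym. exact Hfar.
      + intros s p Hs F F'. exact (Hnc s p Hs F' F).
      + intros x Hx. specialize (Hin' x Hx). split; [lia|apply Hin'].
      + intros x Hx. destruct (Hin x Hx) as [Bx Mx]. split; [|exact Mx].
        destruct (le_lt_dec J (fst x)) as [|Hlt]; [lia|exfalso].
        apply Hearly. intros y Hy. destruct (le_lt_dec J (fst y)) as [|Hlt']; [assumption|exfalso].
        destruct (Hin' y Hy) as [By My].
        destruct (lt_eq_lt_dec (fst x) (fst y)) as [[Hxy|Hxy]|Hxy].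
        * destruct (m_exit c z z' _ (fst y) _ Mx) as [_ F]; auto; [apply Hnc; auto; lia|congruence].
        * rewrite Hxy in Mx.
          assert (snd x = snd y) as Ep by (eapply m_same_level; eauto).
          apply (Hnc (fst y) (snd x)); auto; [lia|]. rewrite Ep. exact My.
        * destruct (m_exit c z' z _ (fst x) _ My) as [_ F]; auto;
            [intro F; apply (Hnc (fst y) (snd y) ltac:(lia) F My)|rewrite Hsym; auto|congruence].
      + lia. }
  unfold h in *. nia.
Qed.

Variable M : nat.
Hypothesis label_lt : forall s p, (label s p < M)%nat.

Let B := (2 * M + 2)%nat.
Let beta := INR (Q * B).

Definition leaf (z : T) (k : nat) : nat -> BTree := fun c => vertex B (word c z k).

Lemma beta_ge1 : 1 <= beta.
Proof. unfold beta. change 1 with (INR 1). apply le_INR. unfold Q, B. nia. Qed.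

Lemma word_good c z k : Forall (good_letter Q B) (word c z k).
Proof. now apply enc_good. Qed.

Lemma word_length c z k : length (word c z k) = length (visits T (m c z) 0 k).
Proof. apply enc_length. Qed.

(** Up to [K] the visits differ by at most one letter, and every further scale adds at most one
    letter to each word. *)
Lemma leaf_color_le c z z' K k l :
  (forall t, (t < K)%nat -> d z z' < theta * tau t) -> (K <= k)%nat -> (K <= l)%nat ->
  tree_dist (leaf z k c) (leaf z' l c) <= beta * (INR (k - K) + INR (l - K) + 1).
Proof.
  intros Hn Hk Hl. destruct (visits_agree c z z' K Hn) as (us & e & e' & E & E' & He).
  destruct (enc_app T Q label us [] 0 eq_refl) as (st & _ & Henc).
  unfold leaf.
  assert (W : exists r, word c z k = enc T Q label [] 0 us ++ r /\ (length r <= length e + (k - K))%nat).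
  { unfold word. rewrite (visits_split T _ K k Hk), E, <- app_assoc, Henc. eexists. split; [reflexivity|].
    rewrite enc_length, length_app. pose proof (visits_length_le T (m c z) K (k - K)). lia. }
  assert (W' : exists r, word c z' l = enc T Q label [] 0 us ++ r /\ (length r <= length e' + (l - K))%nat).
  { unfold word. rewrite (visits_split T _ K l Hl), E', <- app_assoc, Henc. eexists. split; [reflexivity|].
    rewrite enc_length, length_app. pose proof (visits_length_le T (m c z') K (l - K)). lia. }
  destruct W as (r & W & Hr), W' as (r' & W' & Hr').
  pose proof (word_good c z k) as G. pose proof (word_good c z' l) as G'.
  rewrite W in *. rewrite W' in *.
  eapply Rle_trans; [apply (tree_dist_vertex_le Q B _ _ _ G G')|].
  fold beta. apply Rmult_le_compat_l; [pose proof beta_ge1; lra|].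
  rewrite <- !plus_INR. change 1 with (INR 1). rewrite <- plus_INR. apply le_INR. lia.
Qed.

Lemma leaf_dist_le z z' K k l :
  (forall t, (t < K)%nat -> d z z' < theta * tau t) -> (K <= k)%nat -> (K <= l)%nat ->
  prod_dist n (leaf z k) (leaf z' l) <= INR (S n) * beta * (INR (k - K) + INR (l - K) + 1).
Proof.
  intros Hn Hk Hl. unfold prod_dist.
  eapply Rle_trans; [apply sum_Rle; intros c Hc; now apply (leaf_color_le c z z' K k l)|].
  rewrite sum_cte. lra.
Qed.

(** By [m_cover] each scale contributes a letter in at least one colour. *)
Lemma visits_total z a k :
  INR k <= sum_f_R0 (fun c => INR (length (visits T (m c z) a k))) n.
Proof.
  induction k as [|k IH].
  - simpl (INR 0). apply cond_pos_sum. intro. apply pos_INR.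
  - rewrite (sum_eq _ (fun c => INR (length (visits T (m c z) a k)) +
                                INR (length (visits T (m c z) (a + k) 1)))).
    2: { intros c _. rewrite <- plus_INR, <- length_app, <- visits_add. now rewrite Nat.add_1_r. }
    rewrite sum_plus, S_INR.
    destruct (m_cover z (a + k)) as (c & Hc & Hm).
    pose proof (sum_f_R0_term_le (fun c => INR (length (visits T (m c z) (a + k) 1))) n c
      (fun j => pos_INR _) Hc) as H. cbv beta in H.
    assert (E : length (visits T (m c z) (a + k) 1) = 1%nat).
    { unfold visits. simpl. destruct (m c z (a + k)%nat); [reflexivity|now contradict Hm]. }
    rewrite E in H. simpl (INR 1) in H. lra.
Qed.

(** Only lengths matter here: in each colour the longer word has one letter for each visit between
    [l] and [k], up to an error of 1. *)
Lemma leaf_dist_ge_near z z' k l :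
  (forall t, (t < l)%nat -> d z z' < theta * tau t) -> (l <= k)%nat ->
  beta * (INR (k - l) - INR (S n)) <= prod_dist n (leaf z k) (leaf z' l).
Proof.
  intros Hn Hl. unfold prod_dist.
  apply Rle_trans with (sum_f_R0 (fun c => (INR (length (visits T (m c z) l (k - l))) + (- 1)) * beta) n).
  - rewrite <- scal_sum, sum_plus, sum_cte. apply Rmult_le_compat_l; [pose proof beta_ge1; lra|].
    pose proof (visits_total z l (k - l)). lra.
  - apply sum_Rle. intros c _.
    eapply Rle_trans; [|apply (tree_dist_vertex_length Q B); apply word_good].
    fold beta. rewrite Rmult_comm. apply Rmult_le_compat_l; [pose proof beta_ge1; lra|].
    rewrite !word_length, (visits_split T _ l k Hl), length_app, plus_INR.
    destruct (visits_agree c z z' l Hn) as (us & e & e' & E & E' & He).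
    rewrite E, E', !length_app, !plus_INR.
    assert (INR (length e') <= 1) by (change 1 with (INR 1); apply le_INR; lia).
    pose proof (pos_INR (length e)). lra.
Qed.

Lemma leaf_dist_ge_far z z' J k l :
  (forall t, (t < J)%nat -> d z z' < theta * tau t) -> theta * tau J <= d z z' ->
  (J < l)%nat -> (l <= k)%nat ->
  beta * (INR (k - J) / 2 - 4 * INR (S n)) <= prod_dist n (leaf z k) (leaf z' l).
Proof.
  intros Hn Hf HJ Hl. unfold prod_dist.
  (* [q] is the bound per colour for shared letters after separation; over [n + 1] colours it costs
     half of [k - J]. The 4 per colour is 2 from [common_word_bound] and 2 from
     [tree_dist_vertex_ge]. *)
  set (q := INR (k - J) / (2 * INR (S n))).
  assert (Hpos : 0 < INR (S n)) by (apply lt_0_INR; lia).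
  assert (Hq : q * INR (S n) = INR (k - J) / 2) by (unfold q; field; lra). clearbody q.
  apply Rle_trans with (sum_f_R0 (fun c => (INR (length (visits T (m c z) J (k - J))) + (- q - 4)) * beta) n).
  - rewrite <- scal_sum, sum_plus, sum_cte. apply Rmult_le_compat_l; [pose proof beta_ge1; lra|].
    pose proof (visits_total z J (k - J)).
    lra.
  - apply sum_Rle. intros c _.
    destruct (tree_dist_vertex_ge Q B (word c z k) (word c z' l) (word_good _ _ _) (word_good _ _ _))
      as (w & u & v & E & E' & G).
    eapply Rle_trans; [|exact G]. fold beta. rewrite Rmult_comm.
    apply Rmult_le_compat_l; [pose proof beta_ge1; lra|].
    pose proof (common_word_bound c z z' J k l w u v Hn Hf HJ Hl E E') as W.
    apply (f_equal (@length _)) in E. rewrite word_length, length_app in E.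
    rewrite (visits_split T _ J k), length_app in E by lia.
    apply le_INR in W. rewrite !plus_INR, !mult_INR, !plus_INR in W.
    apply (f_equal INR) in E. rewrite !plus_INR in E. rewrite S_INR in *. simpl (INR 2) in W. simpl (INR 1) in W.
    pose proof (pos_INR (length v)).
    assert (INR (length w) <= INR (length (visits T (m c z) 0 J)) + 2 + q).
    { apply Rmult_le_reg_l with (2 * (INR n + 1)); [lra|]. nra. }
    lra.
Qed.

Lemma leaf_dist_sym z z' k l : prod_dist n (leaf z k) (leaf z' l) = prod_dist n (leaf z' l) (leaf z k).
Proof. apply sum_eq. intros c _. apply tree_dist_vertex_sym. Qed.

End Separation.

(** * Laminar covers *)

Section Hierarchy.

Variables (T : Type) (d : T -> T -> R) (n : nat) (tau : nat -> R) (theta : R).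
Variable W : nat -> nat -> (T -> Prop) -> Prop.

Hypothesis d_metric : is_metric d.
Hypothesis tau_pos : forall t, 0 < tau t.
Hypothesis theta_pos : 0 < theta.
Hypothesis theta_small : 10 * theta <= 1.
Hypothesis tau_ratio : forall t, 8 * tau (S t) <= theta * tau t.
Hypothesis W_diam : forall c t A x y, W c t A -> A x -> A y -> d x y <= tau t.
Hypothesis W_separated : forall c t A A' x y, W c t A -> W c t A' -> A <> A' ->
  A x -> A' y -> 5 * theta * tau t <= d x y.
Hypothesis W_cover : forall z t, exists c A, (c <= n)%nat /\ W c t A /\ A z.

(** The radius exceeds [theta * tau t], the tolerance for touching, by more than the displacement
    [theta * tau t / 2] caused by finer members. *)
Definition thick (t : nat) (A : T -> Prop) (u : T) : Prop :=
  exists a, A a /\ d a u < 2 * theta * tau t.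

Inductive conn (c t J : nat) (u : T) : T -> Prop :=
| conn_refl : conn c t J u u
| conn_step v w s A : conn c t J u v -> (t <= s < J)%nat -> W c s A ->
    thick s A v -> thick s A w -> conn c t J u w.

Lemma conn_mono c t J t' J' u v :
  (t' <= t)%nat -> (J <= J')%nat -> conn c t J u v -> conn c t' J' u v.
Proof.
  intros Ht HJ H. induction H as [|v w s A H IH Hs HA Hv Hw]; [constructor|].
  apply (conn_step c t' J' u v w s A); auto. lia.
Qed.

(** A chain meets at most one member of its coarsest scale [t]: two would be [5 * theta * tau t]
    apart, while two thickenings and a finer chain bridge less. So it is a finer chain, one member
    and another finer chain, and induction on the number of scales applies. *)
Lemma conn_diam c k : forall t u v, conn c t (t + k) u v -> d u v <= 4 * tau t.
Proof.
  destruct d_metric as (_ & Hzero & Hsym & Htri).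
  induction k as [|k IH]; intros t u v H.
  - assert (E : u = v).
    { induction H as [|v w s A H E Hs HA Hv Hw]; [reflexivity|lia]. }
    apply Hzero in E. pose proof (tau_pos t). lra.
  - pose proof (tau_ratio t) as Hr. pose proof (tau_pos t) as Hp.
    assert (G : conn c (S t) (S t + k) u v \/
      exists A a a', W c t A /\ thick t A a /\ thick t A a' /\
        conn c (S t) (S t + k) u a /\ conn c (S t) (S t + k) a' v).
    { induction H as [|v w s A H IHG Hs HA Hv Hw]; [left; constructor|].
      destruct (Nat.eq_dec s t) as [->|Hst].
      - right. destruct IHG as [G | (A' & a & a' & HA' & Ha & Ha' & G1 & G2)].
        + exists A, v, w. repeat split; auto. constructor.
        + assert (A' = A) as ->.
          { apply NNPP. intro Hne.
            destruct Ha' as (b & Hb & Hba). destruct Hv as (b' & Hb' & Hbv).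
            pose proof (W_separated c t A' A b b' HA' HA Hne Hb Hb').
            specialize (IH _ _ _ G2).
            pose proof (Htri b a' b'). pose proof (Htri a' v b'). rewrite (Hsym v b') in *. nra. }
          exists A, a, w. repeat split; auto. constructor.
      - destruct IHG as [G | (A' & a & a' & HA' & Ha & Ha' & G1 & G2)].
        + left. apply (conn_step c (S t) (S t + k) u v w s A); auto. lia.
        + right. exists A', a, a'. repeat split; auto.
          apply (conn_step c (S t) (S t + k) a' v w s A); auto. lia. }
    destruct G as [G | (A & a & a' & HA & (b & Hb & Hba) & (b' & Hb' & Hba') & G1 & G2)].
    + apply IH in G. nra.
    + apply IH in G1, G2. pose proof (W_diam c t A b b' HA Hb Hb').
      pose proof (Htri u a v). pose proof (Htri a b v). pose proof (Htri b b' v).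
      pose proof (Htri b' a' v). rewrite (Hsym a b) in *. nra.
Qed.

(** The laminar enlargement of [A]: everything reached from it by chains of finer thickened members
    of the same colour. *)
Definition star (c t : nat) (A : T -> Prop) (v : T) : Prop :=
  exists a J, A a /\ conn c (S t) J a v.

Lemma conn_displacement c t J u v : conn c (S t) J u v -> d u v <= theta * tau t / 2.
Proof.
  intro H. assert (d u v <= 4 * tau (S t)).
  { apply (conn_diam c J). apply (conn_mono c (S t) J); auto; lia. }
  pose proof (tau_ratio t). lra.
Qed.

Lemma star_diam c t A u v : W c t A -> star c t A u -> star c t A v -> d u v <= 2 * tau t.
Proof.
  destruct d_metric as (_ & _ & Hsym & Htri).
  intros HA (a & J & Ha & Hu) (b & J' & Hb & Hv).
  apply conn_displacement in Hu, Hv. pose proof (W_diam c t A a b HA Ha Hb).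
  pose proof (Htri u a v). pose proof (Htri a b v). rewrite (Hsym u a) in *.
  pose proof (tau_pos t). nra.
Qed.

Lemma star_separated c t A A' u v : W c t A -> W c t A' -> A <> A' ->
  star c t A u -> star c t A' v -> theta * tau t <= d u v.
Proof.
  destruct d_metric as (_ & _ & Hsym & Htri).
  intros HA HA' Hne (a & J & Ha & Hu) (b & J' & Hb & Hv).
  apply conn_displacement in Hu, Hv.
  pose proof (W_separated c t A A' a b HA HA' Hne Ha Hb).
  pose proof (Htri a u b). pose proof (Htri u v b). rewrite (Hsym v b) in *.
  pose proof (tau_pos t). nra.
Qed.

Lemma star_thick c t A v w :
  star c t A v -> d v w < theta * tau t -> thick t A w.
Proof.
  destruct d_metric as (_ & _ & _ & Htri).
  intros (a & J & Ha & Hv) H. exists a. split; [exact Ha|].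
  apply conn_displacement in Hv. pose proof (Htri a v w). pose proof (tau_pos t). nra.
Qed.

(** The source of laminarity: [u] and [w] both lie in the thickening of [V], so [V] is one more step
    in a chain issuing from [A]. A finer star that comes near a coarser one is thus swallowed with a
    neighbourhood. *)
Lemma star_absorbs c t s A V u v v' w : (t < s)%nat -> W c s V ->
  star c t A u -> star c s V v -> d u v < theta * tau s ->
  star c s V v' -> d v' w < theta * tau s -> star c t A w.
Proof.
  destruct d_metric as (_ & _ & Hsym & _).
  intros Hts HV (a & J & Ha & Hu) Hv Huv Hv' Hw.
  exists a, (Nat.max J (S s)). split; [exact Ha|].
  apply (conn_step c (S t) _ a u w s V); auto.
  - apply (conn_mono c (S t) J); auto; lia.
  - lia.
  - apply (star_thick c s V v); auto. now rewrite Hsym.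
  - now apply (star_thick c s V v').
Qed.

(** A name is a chosen point of a star. Stars of distinct members of one scale are apart, so names
    determine members; [star_absorbs] gives the exit and nesting properties. *)
Lemma member_names_exist : inhabited T -> exists m : nat -> T -> nat -> option T,
  (forall c z t p, m c z t = Some p -> d z p <= 2 * tau t) /\
  (forall z t, exists c, (c <= n)%nat /\ m c z t <> None) /\
  (forall c z z' t p p', m c z t = Some p -> m c z' t = Some p' ->
     d z z' < theta * tau t -> p = p') /\
  (forall c z z' t s p, m c z t = Some p -> m c z' t <> Some p ->
     (t < s)%nat -> d z z' < theta * tau s -> m c z s = None /\ m c z' s = None) /\
  (forall c z z' t s p, m c z t = Some p -> m c z' t = Some p ->
     (s < t)%nat -> m c z s = m c z' s) /\
  (forall c z z' t p p', m c z t = Some p -> m c z' t = Some p' ->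
     p <> p' -> theta * tau t <= d p p').
Proof.
  intro Hinh. destruct d_metric as (_ & Hzero & Hsym & Htri).
  assert (Hd0 : forall x, d x x = 0) by (intro; now apply Hzero).
  assert (Hpos : forall t, 0 < theta * tau t) by (intro; apply Rmult_lt_0_compat; auto).
  set (rep := fun c t A => epsilon Hinh (star c t A)).
  set (Mem := fun c z t A => W c t A /\ star c t A z).
  assert (Hrep : forall c z t A, Mem c z t A -> star c t A (rep c t A)).
  { intros c z t A [_ H]. apply epsilon_spec. now exists z. }
  assert (Huniq : forall c z z' t A A', Mem c z t A -> Mem c z' t A' ->
    d z z' < theta * tau t -> A = A').
  { intros c z z' t A A' [HA Hz] [HA' Hz'] Hlt. apply NNPP. intro Hne.
    pose proof (star_separated c t A A' z z' HA HA' Hne Hz Hz'). lra. }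
  set (m := fun c z t =>
    match excluded_middle_informative (exists A, Mem c z t A) with
    | left h => Some (rep c t (proj1_sig (constructive_indefinite_description _ h)))
    | right _ => None
    end).
  assert (Hsome : forall c z t p, m c z t = Some p <-> exists A, Mem c z t A /\ p = rep c t A).
  { intros c z t p. unfold m. destruct (excluded_middle_informative _) as [h|h].
    - destruct (constructive_indefinite_description _ h) as [A HA]. simpl. split.
      + intro E. injection E as <-. now exists A.
      + intros (A' & HA' & ->). f_equal. f_equal. apply (Huniq c z z t); auto. now rewrite Hd0.
    - split; [discriminate|]. intros (A & HA & _). exfalso. eauto. }
  assert (Hnone : forall c z t, (forall A, ~ Mem c z t A) -> m c z t = None).
  { intros c z t H. unfold m. destruct (excluded_middle_informative _) as [[A HA]|h]; [|reflexivity].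
    exfalso. now apply (H A). }
  assert (Hmem : forall c z t p, m c z t = Some p -> exists A, Mem c z t A /\ p = rep c t A /\ Mem c p t A).
  { intros c z t p E. apply Hsome in E. destruct E as (A & HA & ->). exists A.
    repeat split; try apply HA. exact (Hrep _ _ _ _ HA). }
  assert (Hsame : forall c z z' t A, Mem c z t A -> Mem c z' t A -> m c z t = m c z' t).
  { intros c z z' t A H H'. transitivity (Some (rep c t A)); [|symmetry]; apply Hsome; now exists A. }
  assert (Habs : forall c t s A V u v v' w, (t < s)%nat -> Mem c u t A -> Mem c v s V ->
    d u v < theta * tau s -> Mem c v' s V -> d v' w < theta * tau s -> Mem c w t A).
  { intros c t s A V u v v' w Hts [HA Hu] [HV Hv] H1 [_ Hv'] H2. split; [exact HA|].
    now apply (star_absorbs c t s A V u v v' w). }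
  exists m. repeat apply conj.
  - intros c z t p E. apply Hmem in E. destruct E as (A & [HA Hz] & -> & [_ Hp]).
    now apply (star_diam c t A).
  - intros z t. destruct (W_cover z t) as (c & A & Hc & HA & Hz). exists c. split; [exact Hc|].
    assert (E : m c z t = Some (rep c t A)).
    { apply Hsome. exists A. repeat split; auto. exists z, 0%nat. split; [exact Hz|constructor]. }
    congruence.
  - intros c z z' t p p' E E' Hlt. apply Hmem in E, E'.
    destruct E as (A & HA & -> & _), E' as (A' & HA' & -> & _). f_equal. eapply Huniq; eauto.
  - intros c z z' t s p E E' Hts Hlt. apply Hmem in E. destruct E as (A & HA & -> & _).
    assert (Hout : ~ Mem c z' t A).
    { intro H. apply E'. apply Hsome. now exists A. }
    (* A star of scale [s] containing [z] or [z'] would be near the star of [A], hence absorbed with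
       its neighbourhood, which contains [z']. *)
    split; apply Hnone; intros V HV; apply Hout.
    + apply (Habs c t s A V z z z z'); auto. now rewrite Hd0.
    + apply (Habs c t s A V z z' z' z'); auto. now rewrite Hd0.
  - intros c z z' t s p E E' Hst. apply Hmem in E. destruct E as (V & HV & -> & _).
    assert (HV' : Mem c z' t V).
    { apply Hmem in E'. destruct E' as (V' & HV' & Er & HVp).
      replace V with V'; [exact HV'|].
      apply (Huniq c (rep c t V) (rep c t V) t); [exact HVp| |now rewrite Hd0].
      split; [apply HV|exact (Hrep _ _ _ _ HV)]. }
    (* The finer star contains both points; if the coarser star of [A] contains one of them, it
       absorbs the other. *)
    destruct (classic (exists A, Mem c z s A \/ Mem c z' s A)) as [[A [HA|HA]]|Hno].
    + apply (Hsame c z z' s A HA). apply (Habs c s t A V z z z' z'); auto; now rewrite Hd0.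
    + refine (Hsame c z z' s A _ HA). apply (Habs c s t A V z' z' z z); auto; now rewrite Hd0.
    + rewrite (Hnone c z s), (Hnone c z' s); auto; intros A HA; apply Hno; eauto.
  - intros c z z' t p p' E E' Hne. apply Hmem in E, E'.
    destruct E as (A & HA & -> & [HW Hp]), E' as (A' & HA' & -> & [HW' Hp']).
    apply (star_separated c t A A'); auto. intros ->. now apply Hne.
Qed.

End Hierarchy.

(** * Capacity dimension and doubling *)

Lemma mesh_bound {T : Type} (d : T -> T -> R) (U : family T) tau A x y :
  Rbar_le (mesh d U) (Finite tau) -> U A -> A x -> A y -> d x y <= tau.
Proof.
  intros H HA Hx Hy. change (Rbar_le (Finite (d x y)) (Finite tau)).
  apply Rbar_le_trans with (diam d A); [apply Rbar_lub_ub; eauto|].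
  apply Rbar_le_trans with (mesh d U); [apply Rbar_lub_ub; eauto|exact H].
Qed.

Lemma Lcov_bound {T : Type} (d : T -> T -> R) (U : family T) eps eta z :
  Rbar_le (Finite eps) (Lcov d U) -> eta < eps ->
  exists A, U A /\ forall w, d z w < eta -> A w.
Proof.
  intros H Heta. apply NNPP. intro Hno.
  assert (G : Rbar_le (Finite eps) (Finite eta)).
  { apply Rbar_le_trans with (Lcov d U); [exact H|].
    apply Rbar_le_trans with (Lz d U z); [apply Rbar_glb_lb; eauto|].
    eapply Rbar_le_trans; [apply Rbar_min_l|].
    apply Rbar_lub_least. intros t (A & HA & ->).
    assert (Hw : exists w, ~ A w /\ d z w < eta).
    { apply NNPP. intro Hw. apply Hno. exists A. split; [exact HA|]. intros w Hlt.
      apply NNPP. intro. apply Hw. eauto. }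
    destruct Hw as (w & Hw & Hlt).
    apply Rbar_le_trans with (Finite (d z w)); [apply Rbar_glb_lb; eauto|].
    simpl. lra. }
  simpl in G. lra.
Qed.

(** Each member is shrunk to the points whose [r]-ball it contains. As [r] is below the Lebesgue
    number the cores still cover, and cores of disjoint sets are at distance at least [r]. *)
Lemma separated_covers_of_cdim {T : Type} (d : T -> T -> R) (n : nat) :
  is_metric d ->
  cdim_witness d n -> exists theta tau0, 0 < theta /\ 10 * theta <= 1 /\ 0 < tau0 /\
  forall tau, 0 < tau -> tau <= tau0 -> exists W : nat -> (T -> Prop) -> Prop,
    (forall c A x y, W c A -> A x -> A y -> d x y <= tau) /\
    (forall c A A' x y, W c A -> W c A' -> A <> A' -> A x -> A' y -> 5 * theta * tau <= d x y) /\
    (forall z, exists c A, (c <= n)%nat /\ W c A /\ A z).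
Proof.
  intros (_ & Hzero & _) (delta & Hdelta & tau0 & Htau0 & H).
  exists (Rmin delta 1 / 10), tau0.
  assert (Hm : 0 < Rmin delta 1) by (apply Rmin_pos; lra).
  pose proof (Rmin_l delta 1) as Hl. pose proof (Rmin_r delta 1).
  repeat split; try lra.
  intros tau Hpos Hle. destruct (H tau Hpos Hle) as (F & Hcol & Hopen & Hmesh & HL).
  set (r := 5 * (Rmin delta 1 / 10) * tau).
  assert (Hr : 0 < r) by (unfold r; nra).
  assert (Hr' : r < delta * tau) by (unfold r; nra).
  set (core := fun (A : T -> Prop) z => forall w, d z w < r -> A w).
  assert (Hcore : forall A z, core A z -> A z).
  { intros A z Hc. apply Hc. replace (d z z) with 0; [exact Hr|]. symmetry. now apply Hzero. }
  exists (fun c A' => (c < S n)%nat /\ exists A, F c A /\ A' = core A). split; [|split].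
  - intros c A' x y (Hc & A & HA & ->) Hx Hy.
    apply (mesh_bound d _ tau A x y Hmesh); [now exists c|now apply Hcore|now apply Hcore].
  - intros c A' B' x y (Hc & A & HA & ->) (Hc' & B & HB & ->) Hne Hx Hy.
    destruct (Rle_lt_dec r (d x y)) as [|Hlt]; [assumption|exfalso].
    apply (Hcol c A B Hc HA HB (fun E => Hne (f_equal core E)) y). split; [now apply Hx|now apply Hcore].
  - intro z. destruct (Lcov_bound d _ _ r z HL Hr') as (A & (c & Hc & HA) & Hz).
    exists c, (core A). repeat split; [lia|exact Hc|eauto|exact Hz].
Qed.

(** * Finite labellings from the doubling property *)

Section Doubling.

Variables (T : Type) (d : T -> T -> R).
Hypothesis d_metric : is_metric d.

Lemma doubling_iterate (C : nat) :
  (forall z rho, 0 < rho -> exists centers : list T, (length centers <= C)%nat /\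
     forall w, ball d z rho w -> exists c, In c centers /\ ball d c (rho / 2) w) ->
  forall i z rho, 0 < rho -> exists centers : list T,
    (length centers <= C ^ i)%nat /\
    forall w, ball d z rho w -> exists c, In c centers /\ ball d c (rho / 2 ^ i) w.
Proof.
  intro H. induction i as [|i IH]; intros z rho Hrho.
  - exists [z]. split; [simpl; lia|]. intros w Hw. exists z. split; [now left|].
    simpl. now replace (rho / 1) with rho by field.
  - destruct (H z rho Hrho) as (cs & Hlen & Hcov).
    assert (G : exists centers : list T, (length centers <= length cs * C ^ i)%nat /\
      forall c w, In c cs -> ball d c (rho / 2) w ->
        exists c', In c' centers /\ ball d c' (rho / 2 / 2 ^ i) w).
    { clear Hlen Hcov. induction cs as [|c cs IHcs].
      - exists []. split; [simpl; lia|]. intros c w [].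
      - destruct IHcs as (l & Hl & Hl'). destruct (IH c (rho / 2) ltac:(lra)) as (l0 & Hl0 & Hl0').
        exists (l0 ++ l). split; [rewrite length_app; simpl; lia|].
        intros c' w [<- | Hc'] Hw.
        + destruct (Hl0' w Hw) as (e & He & Hb). exists e. split; [apply in_or_app; now left|exact Hb].
        + destruct (Hl' c' w Hc' Hw) as (e & He & Hb). exists e.
          split; [apply in_or_app; now right|exact Hb]. }
    destruct G as (l & Hl & Hl'). exists l. split.
    + simpl. apply Nat.le_trans with (length cs * C ^ i)%nat; [exact Hl|].
      now apply Nat.mul_le_mono_r.
    + intros w Hw. destruct (Hcov w Hw) as (c & Hc & Hb). destruct (Hl' c w Hc Hb) as (e & He & Hb').
      exists e. split; [exact He|]. simpl. replace (rho / (2 * 2 ^ i)) with (rho / 2 / 2 ^ i); [exact Hb'|].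
      field. apply pow_nonzero. lra.
Qed.

Definition separated (eps : R) (l : list T) : Prop :=
  NoDup l /\ forall p q, In p l -> In q l -> p <> q -> eps <= d p q.

Lemma separated_subset eps l l' :
  separated eps l -> NoDup l' -> incl l' l -> separated eps l'.
Proof. intros [_ H] Hn Hi. split; auto. Qed.

(** Each ball holds at most one point of [l], so every point of [l] uses up its own centre. *)
Lemma separated_packing eps r (l centers : list T) :
  2 * r <= eps -> separated eps l ->
  (forall w, In w l -> exists c, In c centers /\ ball d c r w) ->
  (length l <= length centers)%nat.
Proof.
  destruct d_metric as (_ & _ & Hsym & Htri).
  revert centers. induction l as [|p l IH]; intros centers Hr Hs Hc; [simpl; lia|].
  destruct (Hc p (or_introl eq_refl)) as (c & Hin & Hb).
  destruct (in_split _ _ Hin) as (l1 & l2 & ->).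
  destruct Hs as [Hnd Hs]. inversion Hnd as [|? ? Hp Hnd']; subst.
  assert (length l <= length (l1 ++ l2))%nat.
  { apply IH; auto.
    - split; auto. intros; apply Hs; simpl; auto.
    - intros w Hw. destruct (Hc w (or_intror Hw)) as (e & He & Hbe).
      exists e. split; [|exact Hbe].
      apply in_elt_inv in He. destruct He as [E | He]; [exfalso; subst e|exact He].
      assert (Hne : p <> w) by (intros ->; contradiction).
      pose proof (Hs p w (or_introl eq_refl) (or_intror Hw) Hne).
      unfold ball in *. pose proof (Htri p c w). rewrite (Hsym p c) in *. lra. }
  rewrite !length_app in *. simpl. lia.
Qed.

Lemma separated_net eps (l : list T) : 0 < eps -> exists l', separated eps l' /\
  forall p, In p l -> exists q, In q l' /\ d p q < eps.
Proof.
  destruct d_metric as (_ & Hzero & Hsym & _). intro Heps.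
  induction l as [|p l IH].
  - exists []. split; [split; [constructor|intros ? ? []]|intros ? []].
  - destruct IH as (l' & [Hnd Hs] & Hn).
    destruct (classic (exists q, In q l' /\ d p q < eps)) as [Hex|Hno].
    + exists l'. split; [split; auto|]. intros p' [<- | Hp']; auto.
    + assert (Hfar : forall q, In q l' -> eps <= d p q).
      { intros q Hq. destruct (Rle_lt_dec eps (d p q)); auto. exfalso. eauto. }
      assert (Hpp : d p p = 0) by (now apply Hzero).
      exists (p :: l'). split; [split|].
      * constructor; auto. intro Hin. specialize (Hfar p Hin). lra.
      * intros a b [<- | Ha] [<- | Hb] Hne; auto; [now contradict Hne|rewrite Hsym; auto].
      * intros p' [<- | Hp'].
        -- exists p. split; [now left|lra].
        -- destruct (Hn p' Hp') as (q & Hq & Hlt). exists q. split; [now right|exact Hlt].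
Qed.

Lemma greedy_coloring (near : T -> T -> Prop) M (l : list T) :
  (forall p q, near p q -> near q p) ->
  (forall p l', In p l -> NoDup l' -> incl l' l -> (forall q, In q l' -> near p q) ->
    (length l' < M)%nat) ->
  NoDup l ->
  exists col : T -> nat, (forall p, In p l -> (col p < M)%nat) /\
    forall p q, In p l -> In q l -> p <> q -> near p q -> col p <> col q.
Proof.
  intros Hsym. induction l as [|p l IH]; intros Hdeg Hnd.
  - exists (fun _ => 0%nat). split; [intros p []|intros p q []].
  - inversion Hnd as [|? ? Hp Hnd']; subst.
    destruct IH as (col & Hlt & Hcol); auto.
    { intros q l' Hq H1 H2 H3. apply (Hdeg q); auto; [now right|intros x Hx; right; auto]. }
    set (nb := filter (fun q => if excluded_middle_informative (near p q) then true else false) l).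
    assert (Hnb : forall q, In q nb <-> In q l /\ near p q).
    { intro q. unfold nb. rewrite filter_In.
      destruct (excluded_middle_informative (near p q)); intuition discriminate. }
    destruct (fresh_color (map col nb) M) as (c & Hc & Hfresh).
    { rewrite length_map. apply (Hdeg p).
      - now left.
      - now apply NoDup_filter.
      - intros q Hq. right. now apply Hnb.
      - intros q Hq. now apply Hnb. }
    exists (fun q => if excluded_middle_informative (q = p) then c else col q). split.
    + intros q Hq. destruct (excluded_middle_informative (q = p)); [exact Hc|].
      destruct Hq as [<- | Hq]; [congruence|auto].
    + intros a b Ha Hb Hne Hnear.
      destruct (excluded_middle_informative (a = p)) as [->|Hap],
               (excluded_middle_informative (b = p)) as [->|Hbp].
      * congruence.
      * destruct Hb as [<- | Hb]; [congruence|]. intros ->. apply Hfresh.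
        apply in_map, Hnb. auto.
      * destruct Ha as [<- | Ha]; [congruence|]. intros <-. apply Hfresh.
        apply in_map, Hnb. auto.
      * destruct Ha as [<- | Ha]; [congruence|]. destruct Hb as [<- | Hb]; [congruence|]. auto.
Qed.

(** A finite [rho / 4]-separated net exists by boundedness. Joining net points closer than
    [(K + 2) * rho] gives a graph whose degree is bounded independently of [rho]; a point takes the
    colour of a net point within [rho / 2]. *)
Lemma doubling_coloring (Delta K : R) : doubling d -> (forall x y, d x y <= Delta) -> 0 <= K ->
  exists M, forall rho, 0 < rho -> exists lab : T -> nat, (forall z, (lab z < M)%nat) /\
    forall z z', rho <= d z z' -> d z z' <= K * rho -> lab z <> lab z'.
Proof.
  intros (C & HC & Hdbl) Hbd HK.
  destruct (classic (inhabited T)) as [[z0]|Hemp].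
  2: { exists 0%nat. intros rho _. exists (fun _ => 0%nat). split; intro z; exfalso; apply Hemp; now constructor. }
  pose proof (doubling_iterate C Hdbl) as Hit.
  destruct (pow2_ge (8 * (K + 2))) as (i & Hi).
  exists (S (C ^ i)). intros rho Hrho.
  destruct d_metric as (Hpos & Hzero & Hsym & Htri).
  assert (Hfin : exists l : list T, forall w, exists c, In c l /\ d c w < rho / 4).
  { set (R0 := Rabs Delta + 1).
    assert (HR0 : 0 < R0) by (unfold R0; pose proof (Rabs_pos Delta); lra).
    destruct (pow2_ge (4 * R0 / rho)) as (i0 & Hi0).
    destruct (Hit i0 z0 R0 HR0) as (l & _ & Hl).
    exists l. intro w. destruct (Hl w) as (c & Hc & Hb).
    - unfold ball. specialize (Hbd z0 w). pose proof (Rle_abs Delta). unfold R0. lra.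
    - exists c. split; [exact Hc|]. eapply Rlt_le_trans; [exact Hb|].
      assert (H2 : 0 < 2 ^ i0) by (apply pow_lt; lra).
      apply Rmult_le_reg_r with (2 ^ i0); [exact H2|].
      replace (R0 / 2 ^ i0 * 2 ^ i0) with R0 by (field; lra).
      apply Rmult_le_compat_l with (r := rho / 4) in Hi0; [|lra].
      replace (rho / 4 * (4 * R0 / rho)) with R0 in Hi0 by (field; lra). exact Hi0. }
  destruct Hfin as (l0 & Hl0).
  destruct (separated_net (rho / 4) l0 ltac:(lra)) as (l & Hsep & Hnet).
  assert (Hcov : forall w, exists q, In q l /\ d w q < rho / 2).
  { intro w. destruct (Hl0 w) as (c & Hc & Hlt). destruct (Hnet c Hc) as (q & Hq & Hlt').
    exists q. split; [exact Hq|]. pose proof (Htri w c q). rewrite (Hsym w c) in *. lra. }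
  destruct (greedy_coloring (fun p q => d p q < (K + 2) * rho) (S (C ^ i)) l) as (col & Hcl & Hcn).
  { intros p q H. now rewrite Hsym. }
  { intros p l' Hp Hnd Hincl Hnear. apply le_n_S.
    destruct (Hit i p ((K + 2) * rho) ltac:(nra)) as (cs & Hcs & Hcc).
    apply Nat.le_trans with (length cs); [|exact Hcs].
    apply (separated_packing (rho / 4) ((K + 2) * rho / 2 ^ i)).
    - assert (H2 : 0 < 2 ^ i) by (apply pow_lt; lra).
      apply Rmult_le_reg_r with (2 ^ i); [exact H2|].
      replace (2 * ((K + 2) * rho / 2 ^ i) * 2 ^ i) with (2 * ((K + 2) * rho)) by (field; lra). nra.
    - now apply (separated_subset _ l).
    - intros w Hw. apply Hcc. now apply Hnear. }
  { apply Hsep. }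
  set (center := fun w => proj1_sig (constructive_indefinite_description _ (Hcov w))).
  assert (Hcen : forall w, In (center w) l /\ d w (center w) < rho / 2).
  { intro w. unfold center. now destruct (constructive_indefinite_description _ (Hcov w)). }
  exists (fun w => col (center w)). split.
  - intro z. apply Hcl, Hcen.
  - intros z z' H1 H2. destruct (Hcen z) as [I1 D1], (Hcen z') as [I2 D2].
    apply Hcn; auto.
    + intro E. rewrite <- E in D2. pose proof (Htri z (center z) z'). rewrite (Hsym (center z) z') in *. lra.
    + pose proof (Htri (center z) z (center z')). pose proof (Htri z z' (center z')).
      rewrite (Hsym (center z) z) in *. lra.
Qed.

End Doubling.

(** * Gromov products and visual metrics *)

Section Gromov.

Variables (X : Type) (d : X -> X -> R).
Hypothesis d_metric : is_metric d.

Lemma gromov_le_l o x y : gromov d o x y <= d o x.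
Proof.
  destruct d_metric as (_ & _ & Hsym & Htri). unfold gromov.
  pose proof (Htri o x y). lra.
Qed.

Lemma gromov_le_r o x y : gromov d o x y <= d o y.
Proof.
  destruct d_metric as (_ & _ & Hsym & Htri). unfold gromov.
  pose proof (Htri o y x). rewrite (Hsym y x) in *. lra.
Qed.

Lemma gromov_nonneg o x y : 0 <= gromov d o x y.
Proof.
  destruct d_metric as (_ & _ & Hsym & Htri). unfold gromov.
  pose proof (Htri x o y). rewrite (Hsym x o) in *. lra.
Qed.

Lemma gromov_sym o x y : gromov d o x y = gromov d o y x.
Proof. destruct d_metric as (_ & _ & Hsym & _). unfold gromov. rewrite (Hsym x y). lra. Qed.

Lemma gromov_basepoint o o' x y : gromov d o' x y - d o o' <= gromov d o x y.
Proof.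
  destruct d_metric as (_ & _ & Hsym & Htri). unfold gromov.
  pose proof (Htri o' o x). pose proof (Htri o' o y). rewrite (Hsym o' o) in *. lra.
Qed.

Lemma gromov_chain delta o x y z :
  delta_hyperbolic d delta -> Rmin (gromov d o x y) (gromov d o y z) - delta <= gromov d o x z.
Proof. intro H. destruct (H o x y z) as (_ & _ & H3). lra. Qed.

Lemma repr_nonempty (xi : boundary d) : exists u, repr xi u.
Proof.
  destruct xi as [S (x & Hx & ->)]. exists x. split; [exact Hx|].
  intros o M. destruct (Hx o M) as [N HN]. exists N. auto.
Qed.

Lemma gromov_bd_nonneg o (xi eta : boundary d) : Rbar_le (Finite 0) (gromov_bd d o xi eta).
Proof.
  apply Rbar_glb_greatest. intros t (u & v & _ & _ & ->). apply LimInf_seq_ge.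
  exists 0%nat. intros. apply gromov_nonneg.
Qed.

(** Passing from the lower limit to a tail costs 1, and moving the base point costs [2 * d o o']. *)
Lemma visual_point_tail o o' D x (xi : boundary d) u :
  Rbar_le (Finite (d o' x)) (Rbar_plus (gromov_pt_bd d o' x xi) (Finite D)) -> repr xi u ->
  exists N, forall i, (N <= i)%nat -> d o x - (D + 1 + 2 * d o o') <= gromov d o x (u i).
Proof.
  destruct d_metric as (_ & _ & Hsym & Htri). intros H Hu.
  assert (G : Rbar_lt (Finite (d o' x - D - 1)) (LimInf_seq (fun i => gromov d o' x (u i)))).
  { apply Rbar_lt_le_trans with (gromov_pt_bd d o' x xi).
    - destruct (gromov_pt_bd d o' x xi); simpl in *; try lra; auto.
    - apply Rbar_glb_lb. eauto. }
  apply LimInf_seq_gt in G. destruct G as [N HN]. exists N. intros i Hi. specialize (HN i Hi).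
  pose proof (gromov_basepoint o o' x (u i)). pose proof (Htri o o' x). lra.
Qed.

(** Hyperbolicity is used twice in each direction, along [u i, x, y, v i] and along
    [x, u i, v i, y], with [(x|u i)_o] at least [|ox| - D']. The real number [g] stands for the
    boundary product, which may be infinite. *)
Lemma boundary_shadows o : hyperbolic d -> visual_space d ->
  exists (C : R) (xi : X -> boundary d), 0 <= C /\ forall x y,
    Rbar_le (Finite (gromov d o x y - C)) (gromov_bd d o (xi x) (xi y)) /\
    forall g : R, Rbar_le (Finite g) (gromov_bd d o (xi x) (xi y)) ->
      Rmin (Rmin (d o x) (d o y)) g - C <= gromov d o x y.
Proof.
  intros (delta & Hdelta & Hhyp) (o' & D & HD & Hvis).
  set (D' := D + 1 + 2 * d o o').
  assert (HD' : 0 <= D') by (destruct d_metric as (Hp & _); pose proof (Hp o o'); unfold D'; lra).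
  exists (D' + 1 + 2 * delta), (fun x => proj1_sig (constructive_indefinite_description _ (Hvis x))).
  split; [lra|]. intros x y.
  destruct (constructive_indefinite_description _ (Hvis x)) as [xi Hxi].
  destruct (constructive_indefinite_description _ (Hvis y)) as [eta Heta]. cbn [proj1_sig].
  split.
  - apply Rbar_glb_greatest. intros t (u & v & Hu & Hv & ->). apply LimInf_seq_ge.
    destruct (visual_point_tail o o' D x xi u Hxi Hu) as [N HN].
    destruct (visual_point_tail o o' D y eta v Heta Hv) as [N' HN'].
    exists (Nat.max N N'). intros i Hi.
    specialize (HN i ltac:(lia)). specialize (HN' i ltac:(lia)). fold D' in HN, HN'.
    pose proof (gromov_chain delta o (u i) x (v i) Hhyp) as H1.
    pose proof (gromov_chain delta o x y (v i) Hhyp) as H2.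
    rewrite (gromov_sym o (u i) x) in H1.
    pose proof (gromov_le_l o x y). pose proof (gromov_le_r o x y).
    unfold Rmin in *. repeat destruct (Rle_dec _ _); lra.
  - intros g Hg.
    destruct (repr_nonempty xi) as [u Hu]. destruct (repr_nonempty eta) as [v Hv].
    destruct (visual_point_tail o o' D x xi u Hxi Hu) as [N HN].
    destruct (visual_point_tail o o' D y eta v Heta Hv) as [N' HN'].
    assert (G : Rbar_lt (Finite (g - 1)) (LimInf_seq (fun i => gromov d o (u i) (v i)))).
    { apply Rbar_lt_le_trans with (Finite g); [simpl; lra|].
      eapply Rbar_le_trans; [exact Hg|]. apply Rbar_glb_lb. eauto. }
    apply LimInf_seq_gt in G. destruct G as [N2 HN2].
    set (i := Nat.max N2 (Nat.max N N')).
    specialize (HN i ltac:(lia)). specialize (HN' i ltac:(lia)). specialize (HN2 i ltac:(lia)).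
    fold D' in HN, HN'. cbv beta in HN2.
    pose proof (gromov_chain delta o x (u i) y Hhyp) as H1.
    pose proof (gromov_chain delta o (u i) (v i) y Hhyp) as H2.
    rewrite (gromov_sym o (v i) y) in H2.
    unfold Rmin in *. repeat destruct (Rle_dec _ _); lra.
Qed.

End Gromov.

Section VisualMetric.

Variables (X : Type) (d : X -> X -> R) (db : boundary d -> boundary d -> R) (o : X) (a c1 c2 : R).
Hypothesis d_metric : is_metric d.
Hypothesis a_gt1 : 1 < a.
Hypothesis c1_pos : 0 < c1.
Hypothesis c2_pos : 0 < c2.
Hypothesis db_visual : forall xi xi', c1 * rpow_neg a (gromov_bd d o xi xi') <= db xi xi' /\
  db xi xi' <= c2 * rpow_neg a (gromov_bd d o xi xi').

Lemma visual_bounded xi xi' : db xi xi' <= c2.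
Proof.
  destruct (db_visual xi xi') as [_ H]. eapply Rle_trans; [exact H|].
  pose proof (gromov_bd_nonneg X d d_metric o xi xi') as G.
  destruct (gromov_bd d o xi xi') as [g| |]; simpl in *; try lra.
  assert (Rpower a (- g) <= 1).
  { rewrite <- (Rpower_O a) by lra. apply Rle_Rpower; lra. }
  nra.
Qed.

Lemma visual_close_product k s xi xi' : 0 < k -> db xi xi' < k * Rpower a (- s) ->
  Rbar_le (Finite (s - (ln k - ln c1) / ln a)) (gromov_bd d o xi xi').
Proof.
  intros Hk H. destruct (db_visual xi xi') as [G _].
  pose proof (gromov_bd_nonneg X d d_metric o xi xi') as N.
  destruct (gromov_bd d o xi xi') as [g| |]; simpl in *; try tauto.
  pose proof (Rpower_neg_le_exponent a c1 k g s a_gt1 c1_pos Hk ltac:(lra)). lra.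
Qed.

Lemma visual_far_product k s xi xi' : 0 < k -> k * Rpower a (- s) <= db xi xi' ->
  Rbar_le (gromov_bd d o xi xi') (Finite (s + (ln c2 - ln k) / ln a)).
Proof.
  intros Hk H. destruct (db_visual xi xi') as [_ G].
  destruct (gromov_bd d o xi xi') as [g| |]; simpl in *; try tauto.
  - apply Rpower_neg_le_exponent; auto. lra.
  (* An infinite product would force distance at most 0. *)
  - assert (0 < k * Rpower a (- s)) by (apply Rmult_lt_0_compat; [lra|apply exp_pos]). lra.
Qed.

End VisualMetric.

(** * The embedding *)

(* [F z k] is the image of the point at height [k] above [z] in the hyperbolic cone over [T]. *)
Lemma cone_embeds_in_trees {T : Type} (d : T -> T -> R) (n : nat) (Delta : R) :
  is_metric d -> doubling d -> (forall x y, d x y <= Delta) -> cdim_witness d n ->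
  exists kappa r beta (F : T -> nat -> nat -> BTree), 0 < kappa /\ 0 < r < 1 /\ 1 <= beta /\
  (forall z z' k l, prod_dist n (F z k) (F z' l) = prod_dist n (F z' l) (F z k)) /\
  forall z z' k l K, (forall t, (t < K)%nat -> d z z' < kappa * r ^ t) -> (K <= l)%nat -> (l <= k)%nat ->
    prod_dist n (F z k) (F z' l) <= INR (S n) * beta * (INR (k - K) + INR (l - K) + 1) /\
    (K = l \/ kappa * r ^ K <= d z z' ->
     beta * (INR (k - K) / 2 - 4 * INR (S n)) <= prod_dist n (F z k) (F z' l)).
Proof.
  intros Hmet Hdbl Hbd Hcdim.
  destruct (separated_covers_of_cdim d n Hmet Hcdim)
    as (theta & tau0 & Hth & Hth10 & Htau0 & Hcov).
  (* The ratio turns [tau_ratio] of the laminar construction into an equality. *)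
  set (r := theta / 8). set (tau := fun t => tau0 * r ^ t).
  assert (Hr : 0 < r < 1) by (unfold r; lra).
  assert (Hrpow : forall t, 0 < r ^ t) by (intro; apply pow_lt; lra).
  assert (Htau : forall t, 0 < tau t) by (intro; unfold tau; apply Rmult_lt_0_compat; auto).
  assert (Hratio : forall t, 8 * tau (S t) = theta * tau t) by (intro t; unfold tau, r; simpl; field).
  assert (Htau_le : forall t, tau t <= tau0).
  { intro t. unfold tau. pose proof (pow_incr r 1 t ltac:(lra)) as P. rewrite pow1 in P. nra. }
  destruct (classic (inhabited T)) as [Hinh|Hemp].
  2: { exists 1, (1 / 2), 1, (fun z _ _ => False_rect _ (Hemp (inhabits z))).
       repeat split; try lra; intros; exfalso; apply Hemp; now constructor. }
  set (W := fun c t => proj1_sig (constructive_indefinite_description _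
    (Hcov (tau t) (Htau t) (Htau_le t))) c).
  assert (HW : forall t,
    (forall c A x y, W c t A -> A x -> A y -> d x y <= tau t) /\
    (forall c A A' x y, W c t A -> W c t A' -> A <> A' -> A x -> A' y -> 5 * theta * tau t <= d x y) /\
    (forall z, exists c A, (c <= n)%nat /\ W c t A /\ A z)).
  { intro t. unfold W. now destruct (constructive_indefinite_description _ _). }
  destruct (member_names_exist T d n tau theta W Hmet Htau Hth Hth10)
    as (m & M1 & M2 & M3 & M4 & M5 & M6); auto.
  { intro t. rewrite Hratio. lra. }
  { intros c t. apply HW. }
  { intros c t. apply HW. }
  { intros z t. now apply HW. }
  (* Times [theta * tau s], the first term exceeds the diameter bound when [s <= 1], and the second
     equals [5 * tau (s - 2)] otherwise: the two cases of [label_separates]. *)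
  set (K0 := Rabs Delta / (theta * tau 1%nat) + 5 / (theta * r ^ 2)).
  assert (HK1 : 0 <= Rabs Delta / (theta * tau 1%nat)).
  { apply Rdiv_le_0_compat; [apply Rabs_pos|apply Rmult_lt_0_compat; auto]. }
  assert (HK2 : 0 <= 5 / (theta * r ^ 2)).
  { apply Rdiv_le_0_compat; [lra|apply Rmult_lt_0_compat; auto]. }
  destruct (doubling_coloring T d Hmet Delta K0 Hdbl Hbd ltac:(unfold K0; lra)) as (M & Hlab).
  assert (Hscale : forall s, 0 < theta * tau s) by (intro; apply Rmult_lt_0_compat; auto).
  set (label := fun s => proj1_sig (constructive_indefinite_description _ (Hlab _ (Hscale s)))).
  assert (Hlabel : forall s, (forall z, (label s z < M)%nat) /\
    forall z z', theta * tau s <= d z z' -> d z z' <= K0 * (theta * tau s) -> label s z <> label s z').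
  { intro s. unfold label. now destruct (constructive_indefinite_description _ _). }
  assert (Hsep : forall s p p', theta * tau s <= d p p' ->
    (s <= 1)%nat \/ d p p' <= 5 * tau (s - 2)%nat -> label s p <> label s p').
  { intros s p p' Hlow Hup. apply Hlabel; [exact Hlow|]. unfold K0. rewrite Rmult_plus_distr_r.
    destruct (le_lt_dec s 1) as [Hs|Hs].
    - assert (Ht1 : tau 1%nat <= tau s).
      { destruct s as [|[|s]]; [|lra|lia]. pose proof (Hratio 0%nat). pose proof (Htau 0%nat). nra. }
      assert (Rabs Delta <= Rabs Delta / (theta * tau 1%nat) * (theta * tau s)).
      { apply Rle_trans with (Rabs Delta / (theta * tau 1%nat) * (theta * tau 1%nat)).
        - right. field. split; [pose proof (Htau 1%nat); lra|lra].
        - apply Rmult_le_compat_l; [exact HK1|]. apply Rmult_le_compat_l; lra. }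
      pose proof (Hbd p p'). pose proof (Rle_abs Delta).
      assert (0 <= 5 / (theta * r ^ 2) * (theta * tau s)).
      { apply Rmult_le_pos; [exact HK2|]. left. apply Hscale. }
      lra.
    - destruct Hup as [Hup|Hup]; [lia|].
      assert (E : 5 / (theta * r ^ 2) * (theta * tau s) = 5 * tau (s - 2)%nat).
      { unfold tau. replace s with (s - 2 + 2)%nat at 1 by lia. rewrite pow_add. field.
        split; apply Rgt_not_eq; lra. }
      rewrite E.
      assert (0 <= Rabs Delta / (theta * tau 1%nat) * (theta * tau s)).
      { apply Rmult_le_pos; [exact HK1|]. left. apply Hscale. }
      lra. }
  assert (Hratio5 : forall t, 5 * tau (S t) <= theta * tau t).
  { intro t. pose proof (Hratio t). pose proof (Htau (S t)). lra. }
  assert (Hlt : forall s p, (label s p < M)%nat) by (intros; apply Hlabel).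
  assert (Hth1 : theta <= 1) by lra.
  assert (Hkappa : forall t, theta * tau0 * r ^ t = theta * tau t) by (intro; unfold tau; ring).
  exists (theta * tau0), r, (INR ((20 * (n + 1) + 1) * (2 * M + 2))), (leaf T n m label M).
  split; [apply Rmult_lt_0_compat; lra|]. split; [exact Hr|]. split; [|split].
  - apply (beta_ge1 n M).
  - intros z z' k l. apply leaf_dist_sym.
  - intros z z' k l K Hn HKl Hlk.
    assert (Hn' : forall t, (t < K)%nat -> d z z' < theta * tau t).
    { intros t Ht. rewrite <- Hkappa. auto. }
    split.
    + apply (leaf_dist_le T d n tau theta m label Hmet); auto. lia.
    + intro Hfar.
      assert (Hb1 := beta_ge1 n M).
      (* For [K = l] no separation is seen below the lower height and the surplus length of the
         longer words suffices; otherwise the diaries separate. *)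
      destruct (Nat.eq_dec K l) as [->|HKne].
      * eapply Rle_trans; [|apply (leaf_dist_ge_near T d n tau theta m label Hmet); eauto].
        apply Rmult_le_compat_l; [lra|].
        pose proof (pos_INR (k - l)). pose proof (pos_INR (S n)). lra.
      * destruct Hfar as [->|Hfar]; [lia|].
        apply (leaf_dist_ge_far T d n tau theta m label Hmet) with (z := z); auto; [|lia].
        now rewrite <- Hkappa.
Qed.

Theorem theorem1p2 (X : Type) (d : X -> X -> R) (n : nat)
  (db : boundary d -> boundary d -> R) :
  is_metric d -> hyperbolic d -> visual_space d ->
  is_metric db -> visual_metric d db -> doubling db ->
  cdim_eq db n ->
  exists f : X -> (nat -> BTree), qi_embedding d (prod_dist n) f.
Proof.
  intros Hd Hhyp Hvis Hdb (o & a & c1 & c2 & Ha & Hc1 & Hc2 & Hvm) Hdbl [Hcdim _].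
  destruct (cone_embeds_in_trees db n c2 Hdb Hdbl
    (visual_bounded X d db o a c1 c2 Hd Ha Hc2 Hvm) Hcdim)
    as (kappa & r & beta & F & Hkappa & Hr & Hbeta & HFsym & HF).
  destruct (boundary_shadows X d Hd o Hhyp Hvis) as (C & xi & HC & Hxi).
  pose proof Hd as (Hdpos & _ & Hdsym & Hdtri).
  assert (Hla : 0 < ln a) by (rewrite <- ln_1; apply ln_increasing; lra).
  assert (Hlr : ln r < 0) by (rewrite <- ln_1; apply ln_increasing; lra).
  (* One scale of the cone corresponds to length [L] in the space, because [r ^ t] equals [a] to the
     power [- L * t]. *)
  set (L := - ln r / ln a).
  assert (HL : 0 < L) by (apply Rdiv_lt_0_compat; lra).
  assert (Hpow : forall t, r ^ t = Rpower a (- (L * INR t))).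
  { intro t. rewrite <- Rpower_pow by lra. unfold Rpower, L. f_equal. field. lra. }
  assert (Hlev : forall x, exists k, L * INR k <= d o x < L * INR k + L).
  { intro x. destruct (nfloor_ex (d o x / L)) as [k [H1 H2]].
    { apply Rdiv_le_0_compat; auto. }
    exists k. split.
    - apply Rmult_le_compat_l with (r := L) in H1; [|lra].
      replace (L * (d o x / L)) with (d o x) in H1 by (field; lra). exact H1.
    - apply Rmult_lt_compat_l with (r := L) in H2; [|lra].
      replace (L * (d o x / L)) with (d o x) in H2 by (field; lra). lra. }
  set (lev := fun x => proj1_sig (constructive_indefinite_description _ (Hlev x))).
  assert (Hlevel : forall x, L * INR (lev x) <= d o x < L * INR (lev x) + L).
  { intro x. unfold lev. now destruct (constructive_indefinite_description _ (Hlev x)). }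
  set (C1 := Rabs ((ln kappa - ln c1) / ln a)). set (C2 := Rabs ((ln c2 - ln kappa) / ln a)).
  assert (HC1 : 0 <= C1) by apply Rabs_pos. assert (HC2 : 0 <= C2) by apply Rabs_pos.
  set (e := 2 * C + 2 * C1 + 2 * C2 + 4 * L).
  assert (Hmain : forall x y, (lev y <= lev x)%nat -> exists P, 
    L * P - e <= d x y <= L * P + e /\
    beta * (P / 4 - 4 * INR (S n)) <= prod_dist n (F (xi x) (lev x)) (F (xi y) (lev y)) <=
    INR (S n) * beta * (P + 1)).
  { intros x y Hle.
    destruct (Hxi x y) as [G1 G2].
    pose proof (Hlevel x) as Lx. pose proof (Hlevel y) as Ly.
    set (near := fun t => db (xi x) (xi y) < kappa * r ^ t).
    assert (Hclose : forall K, (forall t, (t < K)%nat -> near t) -> (K <= lev y)%nat ->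
      L * INR K - L - C1 - C <= gromov d o x y).
    { intros K HK HKl. destruct K as [|K].
      - pose proof (gromov_nonneg X d Hd o x y). simpl. lra.
      - specialize (HK K (Nat.lt_succ_diag_r K)). unfold near in HK. rewrite Hpow in HK.
        pose proof (visual_close_product X d db o a c1 c2 Hd Ha Hc1 Hvm kappa _ _ _ Hkappa HK) as V.
        apply G2 in V.
        pose proof (Rle_abs ((ln kappa - ln c1) / ln a)) as Habs. fold C1 in Habs.
        assert (INR (S K) <= INR (lev y)) by (apply le_INR; lia).
        assert (INR (S K) <= INR (lev x)) by (apply le_INR; lia).
        rewrite S_INR in *.
        unfold Rmin in V. repeat destruct (Rle_dec _ _); nra. }
    assert (Hd2 : d x y = d o x + d o y - 2 * gromov d o x y) by (unfold gromov; lra).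
    destruct (first_before (fun t => ~ near t) (lev y)) as [(J & HJ & Hfar & Hbef) | Hall].
    - assert (Hnear : forall t, (t < J)%nat -> near t).
      { intros t Ht. apply NNPP. now apply Hbef. }
      assert (Hfar' : kappa * r ^ J <= db (xi x) (xi y)).
      { unfold near in Hfar. lra. }
      destruct (HF (xi x) (xi y) (lev x) (lev y) J Hnear ltac:(lia) Hle) as [U Lo].
      specialize (Lo (or_intror Hfar')).
      specialize (Hclose J Hnear ltac:(lia)).
      rewrite Hpow in Hfar'.
      pose proof (visual_far_product X d db o a c1 c2 Ha Hc2 Hvm kappa _ _ _ Hkappa Hfar') as V.
      pose proof (Rbar_le_trans _ _ _ G1 V) as V'. simpl in V'.
      pose proof (Rle_abs ((ln c2 - ln kappa) / ln a)) as Habs. fold C2 in Habs.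
      rewrite (minus_INR (lev x) J) in U, Lo by lia.
      rewrite (minus_INR (lev y) J) in U by lia.
      exists (INR (lev x) - INR J + (INR (lev y) - INR J)).
      split; [unfold e; nra|split; [|exact U]].
      (* As [lev y <= lev x], half of [lev x - J] is at least [P / 4]. *)
      eapply Rle_trans; [|exact Lo]. apply Rmult_le_compat_l; [lra|].
      apply le_INR in Hle. lra.
    - assert (Hnear : forall t, (t < lev y)%nat -> near t).
      { intros t Ht. apply NNPP. now apply Hall. }
      destruct (HF (xi x) (xi y) (lev x) (lev y) (lev y) Hnear ltac:(lia) Hle) as [U Lo].
      specialize (Lo (or_introl eq_refl)).
      specialize (Hclose (lev y) Hnear ltac:(lia)).
      pose proof (gromov_le_r X d Hd o x y).
      rewrite (minus_INR (lev x) (lev y)) in U, Lo by lia.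
      rewrite Nat.sub_diag in U. simpl (INR 0) in U.
      exists (INR (lev x) - INR (lev y)).
      split; [unfold e; nra|split].
      + eapply Rle_trans; [|exact Lo]. apply Rmult_le_compat_l; [lra|].
        apply le_INR in Hle. lra.
      + eapply Rle_trans; [exact U|]. right. ring. }
  exists (fun x => F (xi x) (lev x)).
  set (N := INR (S n)) in *. assert (HN : 0 < N) by (apply lt_0_INR; lia).
  exists (beta / (4 * L)), (N * beta / L), (beta * e / (4 * L) + 4 * beta * N + N * beta * e / L + N * beta).
  assert (He : 0 <= e) by (unfold e; lra).
  assert (HNb : 0 < N * beta) by nra.
  assert (He1 : 0 <= beta * e / (4 * L)) by (apply Rdiv_le_0_compat; nra).
  assert (He2 : 0 <= N * beta * e / L) by (apply Rdiv_le_0_compat; nra).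
  split; [apply Rdiv_lt_0_compat; lra|]. split; [apply Rdiv_lt_0_compat; lra|]. split; [nra|].
  assert (Hfin : forall x y D, (exists P, L * P - e <= d x y <= L * P + e /\
      beta * (P / 4 - 4 * N) <= D <= N * beta * (P + 1)) ->
    beta / (4 * L) * d x y - (beta * e / (4 * L) + 4 * beta * N + N * beta * e / L + N * beta) <= D /\
    D <= N * beta / L * d x y + (beta * e / (4 * L) + 4 * beta * N + N * beta * e / L + N * beta)).
  { intros x y D (P & [D1 D2] & [P1 P2]).
    assert (A1 : beta / (4 * L) * d x y <= beta * P / 4 + beta * e / (4 * L)).
    { replace (beta * P / 4 + beta * e / (4 * L)) with (beta / (4 * L) * (L * P + e)) by (field; lra).
      apply Rmult_le_compat_l; [|lra]. left. apply Rdiv_lt_0_compat; lra. }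
    assert (A2 : N * beta * P - N * beta * e / L <= N * beta / L * d x y).
    { replace (N * beta * P - N * beta * e / L) with (N * beta / L * (L * P - e)) by (field; lra).
      apply Rmult_le_compat_l; [|lra]. left. apply Rdiv_lt_0_compat; lra. }
    assert (0 <= beta * N) by nra.
    split; nra. }
  intros x y. destruct (le_lt_dec (lev y) (lev x)) as [Hle|Hlt].
  - apply Hfin. now apply Hmain.
  - rewrite (Hdsym x y), HFsym. apply Hfin. apply Hmain. lia.
Qed.
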